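(* Fix an integer $n \ge 2$ and a splitting type $\mu \in T_n^{*}$. Let $p$ be a prime and let $K_{\mathfrak p}$ be a finite extension of $\mathbb{Q}_p$ with residue field $\mathbb{F}_q$, $q = p^f$. (1) If $n \ge 3$ and $q > n^2$, then $$\left| \nu_{n,\mathfrak p}\left(P^{*}_{n,\mathfrak p}(\mu)\right) - \nu_n(\mu) \right| < \frac{n^2}{q - n^2}\, \nu_n(\mu).$$ (2) If $n = 2$ and $q \ge n^2 + n$, then $$\left| \nu_{n,\mathfrak p}\left(P^{*}_{n,\mathfrak p}(\mu)\right) - \nu_n(\mu) \right| < \frac{n^2 + n}{q - (n^2 + n)}\, \nu_n(\mu).$$
   Context: $\mathfrak{O}_{\mathfrak p}$ is the ring of integers of $K_{\mathfrak p}$, $\mathfrak p$ its maximal ideal. Let $h_{\mathfrak p}$ be the additive Haar measure on $\mathfrak{O}_{\mathfrak p}$ with total mass $1$, and let $\nu_{n,\mathfrak p}$ be the product measure $h_{\mathfrak p}^{\otimes n}$ on $(\mathfrak{O}_{\mathfrak p})^n$. A tuple $(a_0,\dots,a_{n-1}) \in (\mathfrak{O}_{\mathfrak p})^n$ is identified with the monic polynomial $f(x) = x^n + a_{n-1}x^{n-1} + \cdots + a_0$. $T_n^{*}$ is the set of square-free splitting types of degree $n$, i.e. of partitions $\mu = (\mu_1,\dots,\mu_k)$, $\mu_1 \ge \cdots \ge \mu_k \ge 1$, of $n$. A square-free monic polynomial of degree $n$ has splitting type $\mu$ if the degrees of its monic irreducible factors, in nonincreasing order, are $\mu_1,\dots,\mu_k$.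 $P^{*}_{n,\mathfrak p}(\mu)$ is the set of tuples in $(\mathfrak{O}_{\mathfrak p})^n$ whose polynomial $f$ is square-free with splitting type $\mu$ over $\mathfrak{O}_{\mathfrak p}$ (equivalently over $K_{\mathfrak p}$) and has discriminant not divisible by $\mathfrak p$. For $\mu \in T_n^*$, $C_\mu \subset S_n$ is the conjugacy class of all permutations whose cycle lengths (fixed points included) are $\mu_1,\dots,\mu_k$, and $\nu_n(\mu) = |C_\mu|/n!$. *)

(* Defs.v *)
From HB Require Import structures.
From mathcomp Require Import all_boot all_order all_fingroup all_algebra all_field.
From mathcomp Require Import all_classical all_reals all_analysis.

Set Implicit Arguments.
Unset Strict Implicit.
Unset Printing Implicit Defensive.

Import Order.TTheory GRing.Theory Num.Theory.

Local Open Scope ring_scope.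
Local Open Scope classical_set_scope.

Section PadicInteger.
Variables (p : nat) (p_pr : prime p).

(* Z_p as the inverse limit of the rings Z/p^k: an element is a compatible
   sequence of least nonnegative residues; the equation implies x k < p ^ k. *)
Definition padic_coherent : pred (nat -> nat) :=
  fun x => `[< forall k, x k = (x k.+1 %% p ^ k)%N >].

(* The primality proof is a parameter of the type because the integral domain
   structure below depends on it. *)
Definition padic_integer of prime p := {x : nat -> nat | padic_coherent x}.

Local Notation Zp := (padic_integer p_pr).

HB.instance Definition _ := SubChoice.on Zp.

Implicit Types x y z : Zp.

Lemma padicP x k : val x k = (val x k.+1 %% p ^ k)%N.
Proof. by case: x => x /= /asboolP. Qed.

Lemma padic_mod x k m : (k <= m)%N -> val x k = (val x m %% p ^ k)%N.
Proof.
move=> /subnK <-; elim: (m - k)%N => [|d IHd].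
  by rewrite add0n padicP modn_mod.
by rewrite IHd addSn (padicP x (d + k)) modn_dvdm // dvdn_exp2l // leq_addl.
Qed.

Lemma padic_small x k : (val x k %% p ^ k)%N = val x k.
Proof. by rewrite -padic_mod. Qed.

Lemma padic_inj x y : (forall k, val x k = val y k) -> x = y.
Proof. by move=> eq_xy; apply/val_inj/funext. Qed.

Lemma padic_coherent_mod (u : nat -> nat) :
    (forall k, u k.+1 = u k %[mod p ^ k]) ->
  padic_coherent (fun k => u k %% p ^ k)%N.
Proof.
by move=> u_coh; apply/asboolP=> k; rewrite modn_dvdm ?dvdn_exp2l // u_coh.
Qed.

Definition padic_mk (u : nat -> nat)
    (u_coh : forall k, u k.+1 = u k %[mod p ^ k]) : Zp :=
  exist padic_coherent _ (padic_coherent_mod u_coh).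

Lemma padic_modS x k : val x k.+1 = val x k %[mod p ^ k].
Proof. by rewrite [in RHS]padicP modn_mod. Qed.

Lemma padic_nat_subproof (m k : nat) : m = m %[mod p ^ k]. Proof. by []. Qed.
Definition padic_nat m : Zp := padic_mk (padic_nat_subproof m).

Lemma padic_add_subproof x y k :
  (val x k.+1 + val y k.+1 = val x k + val y k %[mod p ^ k])%N.
Proof. by rewrite -modnDm !padic_modS modnDm. Qed.
Definition padic_add x y := padic_mk (padic_add_subproof x y).

Lemma padic_mul_subproof x y k :
  (val x k.+1 * val y k.+1 = val x k * val y k %[mod p ^ k])%N.
Proof. by rewrite -modnMm !padic_modS modnMm. Qed.
Definition padic_mul x y := padic_mk (padic_mul_subproof x y).

Lemma padic_lt x k : (val x k < p ^ k)%N.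
Proof. by rewrite -padic_small ltn_mod expn_gt0 prime_gt0. Qed.

Lemma padic_opp_subproof x k :
  (p ^ k.+1 - val x k.+1 = p ^ k - val x k %[mod p ^ k])%N.
Proof.
apply/eqP; rewrite -(eqn_modDr (val x k)) subnK ?(ltnW (padic_lt x k)) // modnn.
rewrite -modnDmr -(padic_modS x k) modnDmr subnK ?(ltnW (padic_lt x k.+1)) //.
by rewrite expnS modnMl.
Qed.
Definition padic_opp x := padic_mk (padic_opp_subproof x).

Lemma padic_addA : associative padic_add.
Proof. by move=> x y z; apply: padic_inj => k /=; rewrite modnDml modnDmr addnA. Qed.
Lemma padic_addC : commutative padic_add.
Proof. by move=> x y; apply: padic_inj => k /=; rewrite addnC. Qed.
Lemma padic_add0 : left_id (padic_nat 0) padic_add.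
Proof. by move=> x; apply: padic_inj => k /=; rewrite mod0n padic_small. Qed.
Lemma padic_addN : left_inverse (padic_nat 0) padic_opp padic_add.
Proof.
move=> x; apply: padic_inj => k /=.
by rewrite modnDml subnK ?(ltnW (padic_lt x k)) // modnn mod0n.
Qed.

HB.instance Definition _ := GRing.isZmodule.Build Zp
  padic_addA padic_addC padic_add0 padic_addN.

Lemma padic_mulA : associative padic_mul.
Proof. by move=> x y z; apply: padic_inj => k /=; rewrite modnMml modnMmr mulnA. Qed.
Lemma padic_mulC : commutative padic_mul.
Proof. by move=> x y; apply: padic_inj => k /=; rewrite mulnC. Qed.
Lemma padic_mul1 : left_id (padic_nat 1) padic_mul.
Proof. by move=> x; apply: padic_inj => k /=; rewrite modnMml mul1n padic_small. Qed.
Lemma padic_mulDl : left_distributive padic_mul padic_add.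
Proof.
by move=> x y z; apply: padic_inj => k /=; rewrite modnMml modnDm mulnDl.
Qed.
Lemma padic_1neq0 : padic_nat 1 != 0.
Proof.
apply/eqP=> /(congr1 (fun x : Zp => val x 1%N)) /=.
by rewrite expn1 mod0n modn_small ?prime_gt1.
Qed.

HB.instance Definition _ := GRing.Zmodule_isComNzRing.Build Zp
  padic_mulA padic_mulC padic_mul1 padic_mulDl padic_1neq0.

Definition padic_unit : {pred Zp} := fun x => `[< exists y, y * x = 1 >].
Definition padic_inv x : Zp :=
  if pselect (exists y, y * x = 1) is left ex then projT1 (cid ex) else x.

Lemma padic_mulVx : {in padic_unit, left_inverse 1 padic_inv *%R}.
Proof.
move=> x /asboolP x_unit; rewrite /padic_inv.
by case: pselect => // ex; case: (cid ex).
Qed.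
Lemma padic_unitPl x y : y * x = 1 -> padic_unit x.
Proof. by move=> yx1; apply/asboolP; exists y. Qed.
Lemma padic_inv_out : {in [predC padic_unit], padic_inv =1 id}.
Proof.
move=> x; rewrite inE => /asboolP x_nunit; rewrite /padic_inv.
by case: pselect.
Qed.

HB.instance Definition _ := GRing.ComNzRing_hasMulInverse.Build Zp
  padic_mulVx padic_unitPl padic_inv_out.

Lemma padic_neq0 x : x != 0 ->
  exists a, forall m, (a <= m)%N -> (0 < val x m)%N /\ (logn p (val x m) < a)%N.
Proof.
move=> x_neq0; have [a xa_neq0] : exists a, val x a != 0%N.
  apply: contrapT => /forallNP x0; move/eqP: x_neq0; apply.
  by apply: padic_inj => k; rewrite /= mod0n; apply/eqP; move: (x0 k) => /negP/negPn.
exists a => m le_am; move: xa_neq0; rewrite (padic_mod x le_am) => xa_neq0.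
have xm_gt0 : (0 < val x m)%N.
  by case: (val x m) xa_neq0 => //; rewrite mod0n.
split=> //; rewrite ltnNge -pfactor_dvdn //; exact: xa_neq0.
Qed.

Lemma padic_mulf_eq0 x y : x * y = 0 -> (x == 0) || (y == 0).
Proof.
move=> xy0; apply/norP => -[/padic_neq0[a xP] /padic_neq0[b yP]].
have [x_gt0 lt_xa] := xP (a + b)%N (leq_addr b a).
have [y_gt0 lt_yb] := yP (a + b)%N (leq_addl a b).
have /eqP := congr1 (fun z : Zp => val z (a + b)%N) xy0.
rewrite /= mod0n -/(dvdn _ _) pfactor_dvdn ?muln_gt0 ?x_gt0 // lognM //.
by rewrite leqNgt -addSn leq_add // ltnW.
Qed.

HB.instance Definition _ :=
  GRing.ComUnitRing_isIntegral.Build Zp padic_mulf_eq0.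

End PadicInteger.

Notation padic_number p_pr := {fraction padic_integer p_pr}.

Section RingOfIntegers.
Variables (p : nat) (p_pr : prime p) (K : fieldExtType (padic_number p_pr)).

Definition padic_integer_in : padic_integer p_pr -> K :=
  in_alg K \o @FracField.tofrac (padic_integer p_pr).

Definition integers : {pred K} := fun x => `[< integralOver padic_integer_in x >].

Lemma integers_subring : subring_closed integers.
Proof.
pose f : {rmorphism padic_integer p_pr -> K} :=
  in_alg K \o @FracField.tofrac (padic_integer p_pr).
have fE : f = padic_integer_in :> (_ -> _) by [].
split=> [|x y|x y].
- by apply/asboolP; rewrite -fE; apply: integral1.
- move=> /asboolP x_int /asboolP y_int; apply/asboolP.
  by rewrite -fE; apply: integral_sub.
- move=> /asboolP x_int /asboolP y_int; apply/asboolP.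
  by rewrite -fE; apply: integral_mul.
Qed.

Definition ring_of_integers := {x : K | integers x}.
Local Notation O := ring_of_integers.

HB.instance Definition _ := SubChoice.on O.
HB.instance Definition _ :=
  GRing.SubChoice_isSubComNzRing.Build K integers O integers_subring.
HB.instance Definition _ := isPointed.Build O 0.

(* The topology induced by the absolute value of K: the cosets of the ideals
   p^m O are a base of open sets. *)
Definition padic_open : set_system O :=
  [set U | forall x, U x -> exists m : nat, forall z : O, U (x + p%:R ^+ m * z)].

Lemma padic_openT : padic_open setT. Proof. by move=> x _; exists 0%N. Qed.

Lemma padic_openI : setI_closed padic_open.
Proof.
move=> U V Uop Vop x [/Uop[m xU] /Vop[k xV]].
exists (m + k)%N => z; split.
  by rewrite exprD -mulrA; apply: xU.
by rewrite addnC exprD -mulrA; apply: xV.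
Qed.

Lemma padic_open_bigU (I : Type) (F : I -> set O) :
  (forall i, padic_open (F i)) -> padic_open (\bigcup_i F i).
Proof.
move=> Fop x [i _ /Fop[m xF]]; exists m => z.
by exists i.
Qed.

HB.instance Definition _ :=
  isOpenTopological.Build O padic_openT padic_openI padic_open_bigU.

HB.instance Definition _ :=
  Measurable.copy O (g_sigma_algebraType (@open O)).

End RingOfIntegers.

Arguments ring_of_integers {p p_pr} K.

Definition maximal_ideal (A : comNzRingType) (P : idealr A) :=
  forall I : idealr A, {subset P <= I} -> {subset I <= P}.

Definition residue_field (A : comNzRingType) (P : idealr A) (k : finFieldType) :=
  exists phi : {rmorphism {ideal_quot P} -> k}, bijective phi.

Section Measures.
Variables (R : realType) (p : nat) (p_pr : prime p).
Variable K : fieldExtType (padic_number p_pr).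
Local Notation O := (ring_of_integers K).

Definition haar_measure (h : probability O R) :=
  forall (a : O) (A : set O), measurable A -> h [set a + x | x in A] = h A.

End Measures.

Definition product_measure (R : realType) d (T : measurableType d) (n : nat)
    (h : probability T R) (nu : probability (n.-tuple T) R) :=
  forall A : 'I_n -> set T, (forall i, measurable (A i)) ->
    nu [set t | forall i, A i (tnth t i)] = (\prod_(i < n) h (A i))%E.

Definition is_splitting_type (n : nat) (mu : seq nat) :=
  [&& sorted geq mu, all (leq 1) mu & sumn mu == n].

Definition squarefree_poly (F : fieldType) (f : {poly F}) :=
  forall g : {poly F}, g ^+ 2 %| f -> size g = 1%N.

Definition has_splitting_type (F : fieldType) (mu : seq nat) (f : {poly F}) :=
  exists s : seq {poly F},
    [/\ forall g, g \in s -> g \is monic /\ irreducible_poly g,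
        f = \prod_(g <- s) g
      & sort geq [seq (size g).-1 | g : {poly F} <- s] = mu].

(* For monic f of degree n, Disc f = (-1)^(n(n-1)/2) Res(f, f'). *)
Definition monic_disc (A : comNzRingType) (f : {poly A}) : A :=
  (-1) ^+ 'C((size f).-1, 2) * resultant f f^`().

Definition monic_of_tuple (A : comNzRingType) (n : nat) (a : n.-tuple A) :
  {poly A} := 'X^n + \poly_(i < n) a`_i.

Definition Pstar (p : nat) (p_pr : prime p)
    (K : fieldExtType (padic_number p_pr)) (P : idealr (ring_of_integers K))
    (n : nat) (mu : seq nat) : set (n.-tuple (ring_of_integers K)) :=
  [set a | let f := monic_of_tuple a in
     let fK : {poly K} := map_poly val f in
     [/\ squarefree_poly fK, has_splitting_type mu fK & monic_disc f \notin P]].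

Arguments Pstar {p p_pr K} P n mu.

Definition perm_class (n : nat) (mu : seq nat) : {set 'S_n} :=
  [set s : 'S_n | sort geq [seq #|c| | c : {set 'I_n} <- enum (porbits s)] == mu].

Definition nu_sym (R : realType) (n : nat) (mu : seq nat) : R :=
  #|perm_class n mu|%:R / n`!%:R.

(* Main.v *)
Require Import Defs.
From HB Require Import structures.
From mathcomp Require Import all_boot all_order all_fingroup all_algebra all_field.
From mathcomp Require Import all_solvable.
From mathcomp Require Import all_classical all_reals all_analysis.
From mathcomp Require Import zify ring lra.

(**
Reduction modulo [P] turns the problem into a count over [F_q]: the discriminant
of [f] is a unit iff the reduction of [f] is squarefree, and then [f] and its
reduction have the same splitting type, so that the measure is [N / q^n] with
[N] the number of squarefree monic polynomials of type [mu] over [F_q].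

To count them, order the roots: each of these polynomials has [n!] orderings of
its roots, and all orderings together are the injective tuples [x] over a large
finite field on which Frobenius acts through a permutation [s] of cycle type
[mu].  For each [s] the tuples with [x_a ^ q = x_(s a)] form an [F_q]-space of
[q^n] elements, of which at most [n^2 q^(n-1)] are not injective since each
condition [x_a = x_b] cuts out a proper subspace.  Hence
[(1 - n^2 / q) nu <= N / q^n <= nu], with no formula for either count.

That an irreducible [f] with squarefree reduction has irreducible reduction is
proved without completeness of the ring of integers.  If the reduction splits
as [g h] with [g], [h] coprime, choose [b] congruent to [0] mod [g] and to [1]
mod [h]; its value at a root of [f] is a root of a monic [M] over [Z_p], and the
idempotent [lim X^(r!)] of [Z_p[X]/(M)], evaluated there, lies in a field, hence
is [0] or [1]; but it reduces to [0] mod [g] and to [1] mod [h].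
*)

Set Implicit Arguments.
Unset Strict Implicit.
Unset Printing Implicit Defensive.

Import Order.TTheory GRing.Theory Num.Theory.

Local Open Scope ring_scope.

(** * Tuples on which Frobenius acts through a permutation *)

Section FrobeniusTuples.
Variables (L : finFieldType) (q n : nat).
Hypothesis q_gt1 : (1 < q)%N.
Hypothesis frobB : forall x y : L, (x - y) ^+ q = x ^+ q - y ^+ q.
Hypothesis card_frob_fix : forall i, (0 < i <= n)%N ->
  #|[set y : L | y ^+ (q ^ i) == y]| = (q ^ i)%N.

Implicit Types (s : 'S_n) (x y : {ffun 'I_n -> L}).

Definition frob_tuples s : {set {ffun 'I_n -> L}} :=
  [set x : {ffun 'I_n -> L} | [forall a, x a ^+ q == x (s a)]].

Lemma frob_tuplesP s x :
  reflect (forall a, x a ^+ q = x (s a)) (x \in frob_tuples s).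
Proof. by rewrite inE; apply: (iffP forallP) => xP a; apply/eqP/xP. Qed.

Lemma frob_iterB i (u v : L) : (u - v) ^+ (q ^ i) = u ^+ (q ^ i) - v ^+ (q ^ i).
Proof. by elim: i => [|i IHi]; rewrite ?expr1 // expnSr !exprM IHi frobB. Qed.

Lemma frob_iter_inj i : injective (fun u : L => u ^+ (q ^ i)).
Proof.
move=> u v /eqP; rewrite -subr_eq0 -frob_iterB expf_eq0 => /andP[_].
by rewrite subr_eq0 => /eqP.
Qed.

Lemma frob_tuples_iter s x i a : x \in frob_tuples s ->
  x ((s ^+ i)%g a) = x a ^+ (q ^ i).
Proof.
move=> /frob_tuplesP xP; elim: i => [|i IHi]; first by rewrite perm1 expr1.
by rewrite expgSr permM -xP IHi expnSr exprM.
Qed.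

Lemma frob_iter_fix m i (z : L) :
  z ^+ (q ^ m) = z -> z ^+ (q ^ i) = z ^+ (q ^ (i %% m)).
Proof.
move=> zm; rewrite {1}(divn_eq i m) expnD exprM; congr (_ ^+ _).
elim: (i %/ m)%N => [|j IHj]; first by rewrite expr1.
by rewrite mulSn expnD exprM zm.
Qed.

Lemma porbit_expg_mod s b i : (s ^+ i)%g b = (s ^+ (i %% #|porbit s b|))%g b.
Proof.
rewrite {1}(divn_eq i #|porbit s b|) expgD permM; congr (_ _).
elim: (i %/ _)%N => [|j IHj]; first by rewrite perm1.
by rewrite mulSn expgD permM (_ : (s ^+ #|porbit s b|)%g b = b) ?IHj // permX
  iter_porbit.
Qed.

Lemma porbit_expg_inj s b i j : ((s ^+ i)%g b == (s ^+ j)%g b) =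
  (i == j %[mod #|porbit s b|]).
Proof.
have m_gt0 : (0 < #|porbit s b|)%N by rewrite lt0n card_porbit_neq0.
rewrite porbit_expg_mod [in RHS]eq_sym (porbit_expg_mod s b j) !permX.
have := nth_uniq b (s := traject s b #|porbit s b|)
  (i := i %% #|porbit s b|) (j := j %% #|porbit s b|).
by rewrite size_traject !ltn_mod !nth_traject ?ltn_mod // => ->;
  rewrite ?uniq_traject_porbit // eq_sym.
Qed.

Section Representatives.
Variables (s : 'S_n) (rep : 'I_n -> 'I_n).
Hypothesis rep_porbit : forall a, rep a \in porbit s a.
Hypothesis rep_eq : forall a b, porbit s a = porbit s b -> rep a = rep b.

Lemma porbit_rep a : porbit s (rep a) = porbit s a.
Proof. by apply/eqP; rewrite eq_porbit_mem. Qed.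

Lemma repK a : rep (rep a) = rep a. Proof. exact/rep_eq/porbit_rep. Qed.

(** The value at [(s ^+ i) (rep a)] has to be [y (rep a) ^+ (q ^ i)]. By the hypothesis on [y] this
    power depends on [i] only modulo the length of the orbit, so the values propagate consistently
    along each cycle. *)
Lemma frob_tuples_extend (y : 'I_n -> L) :
    (forall a, a = rep a -> y a ^+ (q ^ #|porbit s a|) = y a) ->
  exists2 x, x \in frob_tuples s & forall a, a = rep a -> x a = y a.
Proof.
move=> yP.
have /fin_all_exists[k kP] : forall a, exists i, a = (s ^+ i)%g (rep a).
  by move=> a; apply/porbitP; rewrite porbit_rep porbit_id.
(* The chosen exponent [k a] may be replaced by any other exponent leading from [rep a] to [a]. *)
have key a i : a = (s ^+ i)%g (rep a) ->
    y (rep a) ^+ (q ^ k a) = y (rep a) ^+ (q ^ i).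
  move=> def_a; have yr := yP (rep a) (esym (repK a)).
  rewrite (frob_iter_fix _ yr) [RHS](frob_iter_fix _ yr); congr (_ ^+ (_ ^ _)).
  by apply/eqP; rewrite -porbit_expg_inj -def_a -kP.
exists [ffun a => y (rep a) ^+ (q ^ k a)].
  apply/frob_tuplesP => a; rewrite !ffunE -exprM -expnSr.
  have rsa : rep (s a) = rep a by apply/rep_eq/(porbit_perm s 1).
  by rewrite -rsa -key // rsa expgSr permM -kP.
by move=> a def_a; rewrite ffunE (key a 0%N) ?expr1 ?perm1 -?def_a.
Qed.

Lemma sum_porbit_rep : (\sum_(a | a == rep a) #|porbit s a| = n)%N.
Proof.
rewrite -[RHS]card_ord -sum1_card [RHS](partition_big rep (fun a => a == rep a)) /=.
  apply: eq_bigr => a /eqP def_a; rewrite -sum1_card; apply: eq_bigl => b.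
  apply/idP/eqP => [|def_b]; last by rewrite -def_b porbit_sym.
  by rewrite -eq_porbit_mem => /eqP/rep_eq->.
by move=> a _; rewrite repK.
Qed.

(** Restriction to the representatives is a bijection onto the product of the fixed sets of
    [z ^+ (q ^ m)], one for each cycle length [m]; their sizes [q ^ m] multiply to [q ^ n] since the
    lengths add up to [n]. *)
Lemma card_frob_tuples_rep : #|frob_tuples s| = (q ^ n)%N.
Proof.
(* Indices that are not representatives get the singleton of [0], so they contribute a factor 1 to
   the size of the family. *)
pose W a : {pred L} := if a == rep a
  then [pred z : L | z ^+ (q ^ #|porbit s a|) == z] else pred1 0.
pose res x : {ffun 'I_n -> L} := [ffun a => if a == rep a then x a else 0].
have -> : #|frob_tuples s| = #|family W|.
  rewrite -(@card_in_imset _ _ res (mem (frob_tuples s))).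
    apply: eq_card => y; apply/imsetP/familyP => [[x xs ->] a|yW].
      rewrite ffunE /W; case: ifP => //= _; last by rewrite inE.
      by rewrite inE -(frob_tuples_iter _ _ xs) permX iter_porbit.
    have [a /eqP|x xs xy] := @frob_tuples_extend y.
      by move=> def_a; have := yW a; rewrite /W def_a inE => /eqP.
    exists x => //; apply/ffunP => a; rewrite ffunE.
    case: eqP => [def_a|/eqP/negPf a_rep]; first by rewrite xy.
    by have := yW a; rewrite /W a_rep inE => /eqP.
  move=> x y xs ys /ffunP eq_xy; apply/ffunP => a.
  have [i ->] : exists i, a = (s ^+ i)%g (rep a).
    by apply/porbitP; rewrite porbit_rep porbit_id.
  by rewrite !frob_tuples_iter //; have := eq_xy (rep a);
    rewrite !ffunE repK eqxx => ->.
rewrite card_family foldrE big_map big_enum /=.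
rewrite -[in RHS]sum_porbit_rep expn_sum [in RHS]big_mkcond /=. apply: eq_bigr => a _.
rewrite /W; case: (a == rep a); last exact: card1.
rewrite -[RHS]card_frob_fix; last first.
  by rewrite lt0n card_porbit_neq0 -[X in (_ <= X)%N]card_ord max_card.
by apply: eq_card => z; rewrite !inE.
Qed.

(** If [a] and [b] lie on different cycles, the indicator of one cycle separates them. On one cycle
    of length [m], they differ by a shift [d] not divisible by [m], and it suffices to start from
    some [z] fixed by the [m]-th power of Frobenius but not by the [d]-th. *)
Lemma frob_tuples_separate a b : a != b ->
  exists2 x, x \in frob_tuples s & x a != x b.
Proof.
move=> neq_ab.
have kP c : exists i, c = (s ^+ i)%g (rep c).
  by apply/porbitP; rewrite porbit_rep porbit_id.
have [eq_rep|neq_rep] := eqVneq (rep a) (rep b); last first.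
  have [c /eqP def_c|x xs xP] := @frob_tuples_extend (fun c => (c == rep a)%:R).
    by case: eqP => _; rewrite ?expr1n // expr0n expn_eq0 -leqn0 leqNgt ltnW.
  have [[i ->] [j ->]] := (kP a, kP b); exists x => //.
  rewrite !frob_tuples_iter // !xP ?repK // eqxx [rep b == _]eq_sym (negPf neq_rep).
  by rewrite expr1n expr0n expn_eq0 -leqn0 leqNgt (ltnW q_gt1) oner_neq0.
wlog [i [d [def_a def_b]]] : a b neq_ab eq_rep /
    exists i d, a = (s ^+ i)%g (rep a) /\ b = (s ^+ (d + i))%g (rep a).
  move=> IH; have [[i def_a] [j def_b]] := (kP a, kP b).
  have [le_ij|lt_ji] := leqP i j.
    by apply: IH => //; exists i, (j - i)%N; rewrite subnK // {2}eq_rep.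
  have [||//|x xs] := IH b a; rewrite 1?eq_sym //; last by exists x; rewrite // eq_sym.
  by exists j, (i - j)%N; rewrite subnK ?(ltnW lt_ji) // -{2}eq_rep.
set r := rep a in def_a def_b; set m := #|porbit s r|.
have m_gt0 : (0 < m)%N by rewrite lt0n card_porbit_neq0.
have le_mn : (m <= n)%N by rewrite -[X in (_ <= X)%N]card_ord max_card.
have d_gt0 : (0 < d %% m)%N.
  rewrite lt0n; apply: contra neq_ab => d0; rewrite def_a def_b porbit_expg_inj.
  by rewrite eq_sym -modnDml (eqP d0) add0n.
(* Otherwise a set of [q ^ m] elements would lie in one of [q ^ (d %% m)] elements, although
   [d %% m < m]. *)
have [z zm zd] : exists2 z : L, z ^+ (q ^ m) = z & z ^+ (q ^ (d %% m)) != z.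
  apply/exists2P/not_existsP => no_z.
  have : (#|[set z : L | z ^+ (q ^ m) == z]| <=
          #|[set z : L | z ^+ (q ^ (d %% m)) == z]|)%N.
    apply/subset_leq_card/fintype.subsetP => z; rewrite !inE => /eqP zm.
    by apply/negPn/negP => zd; apply: (no_z z).
  have lt_dm : (d %% m < m)%N by rewrite ltn_mod.
  rewrite !card_frob_fix ?d_gt0 ?m_gt0 ?le_mn //; last exact: leq_trans (ltnW lt_dm) _.
  by rewrite leq_exp2l // leqNgt lt_dm.
have [c /eqP def_c|x xs xP] := @frob_tuples_extend
    (fun c => if c == r then z else 0).
  case: eqP => [-> //|_]; by rewrite expr0n expn_eq0 -leqn0 leqNgt ltnW.
exists x => //; rewrite def_a def_b !frob_tuples_iter // !xP ?repK // eqxx.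
rewrite expnD exprM; apply: contra zd => /eqP/frob_iter_inj {2}->.
by rewrite -(frob_iter_fix _ zm).
Qed.

End Representatives.

Lemma porbit_representatives s : exists rep : 'I_n -> 'I_n,
  (forall a, rep a \in porbit s a) /\
  (forall a b, porbit s a = porbit s b -> rep a = rep b).
Proof.
have ex a : exists b, b \in porbit s a by exists a; apply: porbit_id.
by exists (fun a => xchoose (ex a)); split=> [a|a b eq_ab];
  [exact: xchooseP | apply: eq_xchoose => c; rewrite eq_ab].
Qed.

Lemma card_frob_tuples s : #|frob_tuples s| = (q ^ n)%N.
Proof.
by have [rep [repP rep_eq]] := porbit_representatives s;
  exact: card_frob_tuples_rep repP rep_eq.
Qed.

Lemma card_frob_tuples_eq s a b : a != b ->
  (#|[set x in frob_tuples s | x a == x b]| * q <= q ^ n)%N.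
Proof.
have [rep [repP rep_eq]] := porbit_representatives s.
move=> /(frob_tuples_separate repP rep_eq)[v vs neq_v].
have n_gt0 : (0 < n)%N by apply: leq_trans (ltn_ord a).
have cardF : #|[set y : L | y ^+ q == y]| = q.
  by rewrite -[RHS]expn1 -card_frob_fix ?n_gt0.
rewrite -{1}cardF -cardsX -(card_frob_tuples s).
(* As [v a <> v b], the translates [x + z v] of the tuples with [x a = x b], for
   [z] fixed by Frobenius, are disjoint. *)
pose g (u : {ffun 'I_n -> L} * L) : {ffun 'I_n -> L} :=
  [ffun c => u.1 c - u.2 * - v c].
rewrite -(@card_in_imset _ _ g); last first.
  move=> [x z] [y w]; rewrite !inE /= => /andP[/andP[_ /eqP xab] _] /andP[/andP[_
    /eqP yab] _].
  move=> /ffunP eq_g; have := (eq_g a, eq_g b); rewrite !ffunE /= => -[ga gb].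
  have eq_zw : z = w.
    suff /eqP : (z - w) * (v a - v b) = 0.
      by rewrite mulf_eq0 !subr_eq0 (negPf neq_v) orbF => /eqP.
    have : (x a - z * - v a) - (x b - z * - v b) = (y a - w * - v a) - (y b - w * - v
      b).
      by rewrite ga gb.
    rewrite xab yab => /eqP; rewrite -subr_eq0 => /eqP eq0; rewrite -[RHS]eq0; ring.
  rewrite eq_zw in eq_g *; congr (_, _); apply/ffunP => c.
  by have := eq_g c; rewrite !ffunE /= => /addIr.
apply/subset_leq_card/fintype.subsetP => y /imsetP[[x z]].
rewrite !inE /= => /andP[/andP[/forallP xs _] /eqP zq] ->; apply/forallP => c.
rewrite !ffunE /= frobB exprMn zq (eqP (xs c)) -(frob_tuplesP _ _ vs).
by rewrite -[- v c]sub0r frobB expr0n -[q == 0%N]negbK -lt0n ltnW // sub0r.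
Qed.

(** Union bound: a non-injective tuple has [x a = x b] for one of at most [n ^ 2] ordered pairs. The
    inequality is multiplied by [q] so that no exponent [n - 1] appears. *)
Lemma card_frob_tuples_inj s :
  (q ^ n * q <= #|[set x in frob_tuples s | injectiveb x]| * q + n ^ 2 * q ^ n)%N.
Proof.
rewrite -(card_frob_tuples s) -(cardsID [set x : {ffun 'I_n -> L} | injectiveb x]
  (frob_tuples s)).
rewrite mulnDl; apply: leq_add.
  by rewrite leq_mul2r; apply/orP; right; apply/subset_leq_card/fintype.subsetP => x;
    rewrite !inE.
rewrite (cardsID [set x : {ffun 'I_n -> L} | injectiveb x] (frob_tuples s))
  card_frob_tuples.
pose D (ab : 'I_n * 'I_n) := [set x in frob_tuples s | x ab.1 == x ab.2].
have sub : frob_tuples s :\: [set x : {ffun 'I_n -> L} | injectiveb x] \subset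
    \bigcup_(ab : 'I_n * 'I_n | ab.1 != ab.2) D ab.
  apply/fintype.subsetP => x;
    rewrite !inE => /andP[/injectivePn[a [b neq_ab eq_ab]] xs].
  by apply/finset.bigcupP; exists (a, b); rewrite // !inE xs /= eq_ab.
apply: leq_trans (_ : (\sum_(ab : 'I_n * 'I_n | ab.1 != ab.2) #|D ab|) * q <= _)%N.
  rewrite leq_mul2r; apply/orP; right; apply: leq_trans (subset_leq_card sub) _.
  elim/big_rec2: _ => [|ab k A _ le_A]; first by rewrite cards0.
  by apply: leq_trans (leq_card_setU _ _) _; rewrite leq_add2l.
rewrite big_distrl /=;
  apply: leq_trans (_ : \sum_(ab : 'I_n * 'I_n | ab.1 != ab.2) q ^ n <= _)%N.
  by apply: leq_sum => ab; apply: card_frob_tuples_eq.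
rewrite sum_nat_const leq_mul2r; apply/orP; right.
by apply: leq_trans (max_card _) _; rewrite card_prod card_ord mulnn.
Qed.

End FrobeniusTuples.

(** * Frobenius and polynomials over a finite field *)

Section FrobeniusPoly.
Variables (F L : finFieldType) (iota : {rmorphism F -> L}).
Local Notation q := #|F|.
Local Notation "p ^i" := (map_poly iota p) (at level 2, format "p ^i").

Lemma pchar_nat_card : [pchar L].-nat q.
Proof.
have [p p_pr charFp] := finPcharP F.
have charLp : p \in [pchar L] by rewrite (rmorph_pchar iota).
rewrite (eq_pnat _ (pcharf_eq charLp)).
by have := pprimeChar_pgroup charFp; rewrite /pgroup cardsT.
Qed.

Definition frobq (z : L) := z ^+ q.

Lemma frobq_zmod_morphism : zmod_morphism frobq.
Proof.
move=> x y; apply/eqP; rewrite eq_sym subr_eq; apply/eqP.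
by rewrite /frobq -exprDn_pchar ?subrK // pchar_nat_card.
Qed.

Lemma frobq_monoid_morphism : monoid_morphism frobq.
Proof. by split=> [|x y]; rewrite /frobq ?expr1n ?exprMn. Qed.

HB.instance Definition _ := GRing.isZmodMorphism.Build L L frobq
  frobq_zmod_morphism.
HB.instance Definition _ := GRing.isMonoidMorphism.Build L L frobq
  frobq_monoid_morphism.

Lemma frobq_inj : injective frobq. Proof. exact: fmorph_inj. Qed.

Lemma frobq_iota c : frobq (iota c) = iota c.
Proof. by rewrite /frobq -rmorphXn expf_card. Qed.

(** Over [F] the polynomial [X^q - X] is the product of all [X - c], so its roots in [L] come from
    [F]. *)
Lemma frobq_fix z : frobq z = z -> exists c, z = iota c.
Proof.
move=> zq; have : root ('X^q - 'X)^i z.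
  by rewrite rmorphB /= map_polyXn map_polyX rootE !hornerE -/(frobq z) zq subrr.
rewrite finField_genPoly rmorph_prod rootE horner_prod prodf_seq_eq0 => /hasP[c _ /=].
by rewrite map_polyXsubC -rootE root_XsubC => /eqP->; exists c.
Qed.

(** Frobenius permutes the roots, hence fixes every coefficient of the product, and fixed elements
    come from [F]. *)
Lemma prod_XsubC_descends (r : seq L) : perm_eq (map frobq r) r ->
  exists g : {poly F}, g^i = \prod_(z <- r) ('X - z%:P).
Proof.
move=> rq; set P := \prod_(z <- r) _.
have PE : map_poly frobq P = P.
  rewrite rmorph_prod /=; under eq_bigr do rewrite map_polyXsubC.
  by rewrite -[RHS](perm_big _ rq) big_map.
have coefP i : exists c, P`_i = iota c.
  by apply: frobq_fix; rewrite -coef_map PE.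
have [c cP] := choice coefP.
exists (\poly_(i < size P) c i); apply/polyP => i; rewrite coef_map coef_poly.
by case: ltnP => [_|le_Pi]; [rewrite cP | rewrite (nth_default _ le_Pi) raddf0].
Qed.

Lemma root_frobq (h : {poly F}) z : root h^i z -> root h^i (frobq z).
Proof.
move=> /rootP hz; rewrite rootE -[h^i](_ : map_poly frobq h^i = h^i).
  by rewrite horner_map hz raddf0.
by apply/polyP => i; rewrite !coef_map /= frobq_iota.
Qed.

Local Notation conjugates z := (fingraph.orbit frobq z).

Lemma root_conjugates (h : {poly F}) z w :
  root h^i z -> w \in conjugates z -> root h^i w.
Proof.
move=> hz; rewrite -fconnect_orbit => /iter_findex <-.
by elim: (findex _ _ _) => //= k; apply: root_frobq.
Qed.

Lemma dvdp_conjugates (P : {poly L}) (r : seq L) :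
  uniq r -> {in r, forall w, root P w} -> \prod_(w <- r) ('X - w%:P) %| P.
Proof.
by move=> r_uniq rP; apply: uniq_roots_dvdp; [apply/allP|rewrite uniq_rootsE].
Qed.

(** This [g] is the minimal polynomial of [z] over [F]. *)
Lemma conjugates_poly z : exists2 g : {poly F},
  g^i = \prod_(w <- conjugates z) ('X - w%:P) & g \is monic.
Proof.
have uq := fingraph.orbit_uniq frobq z.
have [|g gE] := @prod_XsubC_descends (conjugates z).
  have uq' : uniq (map frobq (conjugates z)) by rewrite (map_inj_uniq frobq_inj).
  apply: uniq_perm => //.
  (* Frobenius maps the finite orbit injectively into itself, hence permutes it. *)
  have [w /mapP[v vz ->]||//] := @uniq_min_size _ _ (conjugates z) uq';
    last by rewrite size_map.
  by rewrite -!fconnect_orbit in vz *; exact: (connect_trans vz (fconnect1 _ _)).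
by exists g => //; rewrite -(map_monic iota) gE monic_prod_XsubC.
Qed.

Lemma irreducible_conjugates (g : {poly F}) z :
  g \is monic -> irreducible_poly g -> root g^i z ->
  g^i = \prod_(w <- conjugates z) ('X - w%:P).
Proof.
move=> g_mon [_ g_irr] gz; have [h hE h_mon] := conjugates_poly z.
have hg : h %| g.
  rewrite -(dvdp_map iota) hE dvdp_conjugates ?fingraph.orbit_uniq // => w.
  exact: root_conjugates.
suff /eqP <- : h == g by [].
rewrite -eqp_monic // g_irr // -(size_map_poly iota) hE size_prod_XsubC.
by rewrite /fingraph.orbit size_traject eqSS -lt0n fingraph.order_gt0.
Qed.

(** * Splitting type of a polynomial and cycle type of Frobenius on its roots *)

Section CycleType.
Variable n : nat.
Implicit Types (s : 'S_n) (x : {ffun 'I_n -> L}) (f g h : {poly F}).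

Definition root_poly x : {poly L} := \prod_a ('X - (x a)%:P).

Lemma root_root_poly x z : reflect (exists a, z = x a) (root (root_poly x) z).
Proof.
rewrite /root_poly rootE horner_prod.
apply: (iffP (prodf_eq0 _ _)) => [[a _]|[a ->]]; last first.
  by exists a; rewrite // !hornerE subrr.
by rewrite -rootE root_XsubC => /eqP->; exists a.
Qed.

Lemma mem_conjugates_frob_tuples s x a b :
  x \in frob_tuples L q s -> injective x ->
  (x b \in conjugates (x a)) = (b \in porbit s a).
Proof.
move=> xs x_inj; have itE k : iter k frobq (x a) = x ((s ^+ k)%g a).
  rewrite (frob_tuples_iter _ _ xs); elim: k => [|k IHk]; rewrite ?expr1 //=.
  by rewrite IHk /frobq -exprM -expnSr.
rewrite -fconnect_orbit; apply/idP/porbitP => [/iter_findex|[k ->]].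
  by rewrite itE => /x_inj<-; exists (findex frobq (x a) (x b)).
by rewrite -itE; apply: fconnect_iter.
Qed.

(** A nonconstant [g] whose square divides [f] has some [x a] as a root in [L]; this would be a
    double root, against the injectivity of [x]. *)
Lemma root_poly_squarefree f x :
  injective x -> f^i = root_poly x -> squarefree_poly f.
Proof.
move=> x_inj fx g g2f; apply/eqP; apply: contraT => g_size.
have g2 : g^i ^+ 2 %| root_poly x by rewrite -fx -rmorphXn /= dvdp_map.
have gf : g^i %| root_poly x by apply: dvdp_trans g2; rewrite exprS dvdp_mulIl.
have [m] := dvdp_prod_XsubC gf; case def_m: (mask _ _) => [|a r] gE.
  by move: gE; rewrite big_nil -size_poly_eq1 size_map_poly (negPf g_size).
have ga : 'X - (x a)%:P %| g^i by rewrite (eqp_dvdr _ gE) big_cons dvdp_mulIl.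
have : ('X - (x a)%:P) ^+ 2 %| root_poly x by apply: dvdp_trans g2; rewrite dvdp_exp2r.
rewrite /root_poly (bigD1 a) //= expr2 dvdp_mul2l ?polyXsubC_eq0 // dvdp_XsubCl.
rewrite rootE horner_prod => /prodf_eq0[b neq_ba].
by rewrite -rootE root_XsubC => /eqP/x_inj eq_ab; rewrite eq_ab eqxx in neq_ba.
Qed.

Lemma irreducible_root_poly g f x : g \is monic -> irreducible_poly g -> g %| f ->
  f^i = root_poly x -> exists a, root g^i (x a).
Proof.
move=> g_mon [g_gt1 _] gf fx.
have gx : g^i %| root_poly x by rewrite -fx dvdp_map.
have [m] := dvdp_prod_XsubC gx; case def_m: (mask _ _) => [|a r] gE.
  by move: gE; rewrite big_nil -size_poly_eq1 size_map_poly eqn_leq leqNgt g_gt1.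
by exists a; rewrite -dvdp_XsubCl (eqp_dvdr _ gE) big_cons dvdp_mulIl.
Qed.

Lemma uniq_irreducible_factors (r : seq {poly F}) :
    {in r, forall g, irreducible_poly g} ->
  squarefree_poly (\prod_(g <- r) g) -> uniq r.
Proof.
move=> r_irr sqf; apply: contraT => /(uniqPn 0)[i [j [lt_ij lt_jr eq_g]]].
have gr : r`_j \in r by apply: mem_nth.
have [g_gt1 _] := r_irr _ gr.
have : r`_j ^+ 2 %| \prod_(g <- r) g.
  have lt_ir := ltn_trans lt_ij lt_jr.
  rewrite (big_nth 0) big_mkord (bigD1 (Ordinal lt_ir)) //=.
  rewrite (bigD1 (Ordinal lt_jr)) /=; last by rewrite -val_eqE /= gtn_eqF.
  by rewrite eq_g mulrA expr2 dvdp_mulIl.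
by move=> /sqf size_g; rewrite size_g in g_gt1.
Qed.

(** Attach to an irreducible factor [g] the set [Z g] of indices of its roots. The roots of [g] are
    a single Frobenius orbit, so [Z g] is a cycle of [s] with [deg g] elements, and [Z] is a
    bijection from the factors to the cycles. *)
Lemma splitting_type_perm_class f s x mu :
    injective x -> x \in frob_tuples L q s -> f^i = root_poly x ->
  has_splitting_type mu f -> s \in perm_class n mu.
Proof.
move=> x_inj xs fx [r [r_irr def_f <-]]; rewrite inE.
pose Z g := [set a | root g^i (x a)].
have rP g : g \in r -> [/\ g \is monic, irreducible_poly g & g %| f].
  move=> gr; have [g_mon g_irr] := r_irr g gr; split=> //.
  by rewrite def_f (perm_big _ (perm_to_rem gr)) big_cons dvdp_mulIl.
have ZP g a : g \in r -> root g^i (x a) -> Z g = porbit s a.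
  move=> gr ga; have [g_mon g_irr gf] := rP g gr.
  apply/setP => b; rewrite -(mem_conjugates_frob_tuples a b xs x_inj) inE.
  rewrite (irreducible_conjugates g_mon g_irr ga) rootE horner_prod prodf_seq_eq0.
  apply/hasP/idP => [[w wa] /=|ba]; last by exists (x b); rewrite //= !hornerE subrr.
  by rewrite -rootE root_XsubC => /eqP->.
have sizeZ g : g \in r -> #|Z g| = (size g).-1.
  move=> gr; have [g_mon g_irr gf] := rP g gr.
  have [a ga] := irreducible_root_poly g_mon g_irr gf fx.
  rewrite -(size_map_poly iota) (irreducible_conjugates g_mon g_irr ga).
  rewrite size_prod_XsubC /= -(card_uniqP (fingraph.orbit_uniq frobq _)).
  rewrite -(card_imset _ x_inj); apply: eq_card => w; rewrite (ZP g a) //.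
  apply/imsetP/idP => [[b ba ->]|wa];
    first by rewrite (mem_conjugates_frob_tuples _ _ xs x_inj).
  have /root_root_poly[b def_w] : root (root_poly x) w.
    rewrite -fx; apply: root_conjugates wa; rewrite fx.
    by apply/root_root_poly; exists a.
  by exists b; rewrite // -(mem_conjugates_frob_tuples a b xs x_inj) -def_w.
have r_uniq : uniq r.
  apply: uniq_irreducible_factors => [g /rP[]//|].
  by rewrite -def_f; apply: root_poly_squarefree x_inj fx.
have Z_inj : {in r &, injective Z}.
  move=> g h gr hr eqZ; have [[g_mon g_irr gf] [h_mon h_irr hf]] := (rP g gr, rP h hr).
  have [a ga] := irreducible_root_poly g_mon g_irr gf fx.
  have ha : root h^i (x a) by have /setP/(_ a) := eqZ; rewrite !inE ga => <-.
  apply: (map_poly_inj iota).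
  by rewrite (irreducible_conjugates g_mon g_irr ga) (irreducible_conjugates h_mon
    h_irr ha).
apply/eqP/perm_sortP.
- by move=> k l; apply: leq_total.
- by move=> k l m /= le_kl le_mk; apply: leq_trans le_kl.
- by move=> k l; rewrite /= andbC -eqn_leq => /eqP.
have -> : [seq (size g).-1 | g <- r] = [seq #|c| | c : {set 'I_n} <- map Z r].
  by rewrite -map_comp; apply/eq_in_map => g gr; rewrite /= sizeZ.
apply: perm_map; apply: uniq_perm; rewrite ?enum_uniq ?map_inj_in_uniq // => c.
rewrite mem_enum; apply/imsetP/mapP => [[a _ ->]|[g gr ->]].
  have : root (f^i) (x a) by rewrite fx; apply/root_root_poly; exists a.
  rewrite def_f rmorph_prod rootE horner_prod prodf_seq_eq0 => /hasP[g gr /=].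
  by rewrite -rootE => ga; exists g; rewrite // (ZP g a).
have [g_mon g_irr gf] := rP g gr.
have [a ga] := irreducible_root_poly g_mon g_irr gf fx.
by exists a; rewrite // (ZP g a).
Qed.

End CycleType.

End FrobeniusPoly.

(** * Counting squarefree polynomials by splitting type *)

Lemma monic_irreducible_factorization (F : fieldType) (f : {poly F}) :
  f \is monic -> exists2 s : seq {poly F},
    forall g, g \in s -> g \is monic /\ irreducible_poly g & f = \prod_(g <- s) g.
Proof.
have [k] := ubnP (size f); elim: k f => // k IHk f /ltnSE le_fk f_mon.
have [f_irr|f_nirr] := pselect (irreducible_poly f).
  by exists [:: f]; rewrite ?big_seq1 // => g; rewrite inE => /eqP->.
have [f_le1|f_gt1] := leqP (size f) 1.
  exists [::] => //; rewrite big_nil; apply/eqP;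
    rewrite -eqp_monic ?monic1 // -size_poly_eq1.
  by rewrite eqn_leq f_le1 size_poly_gt0 monic_neq0.
have [g [g_size gf ngf]] : exists g : {poly F}, [/\ size g != 1%N, g %| f & ~~ (g %=
  f)].
  apply: contrapT => no_g; apply: f_nirr; split=> // g g_size gf.
  by apply/negPn/negP => ngf; apply: no_g; exists g.
have f_neq0 := monic_neq0 f_mon.
have g_neq0 : g != 0 by apply: dvdpN0 gf f_neq0.
have lc_neq0 : lead_coef g != 0 by rewrite lead_coef_eq0.
pose g1 := (lead_coef g)^-1 *: g.
have g1_mon : g1 \is monic by rewrite monicE lead_coefZ mulVf.
have eq_size_g : size g1 = size g by rewrite size_scale ?invr_eq0.
have [h def_f] : exists h, f = h * g1.
  by exists (f %/ g1); rewrite divpK // dvdpZl ?invr_eq0.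
have h_mon : h \is monic by rewrite -(monicMr _ g1_mon) -def_f.
have size_f : size f = (size h + size g1).-1 by rewrite def_f size_monicM ?monic_neq0.
have g_gt1 : (1 < size g)%N by rewrite ltn_neqAle eq_sym g_size size_poly_gt0.
have lt_hf : (size h < size f)%N.
  rewrite size_f eq_size_g; case: (size g) g_gt1 => [|[|m]] // _.
  by rewrite !addnS ltnS leq_addr.
have lt_gf : (size g < size f)%N.
  by rewrite ltn_neqAle dvdp_leq // andbT; apply: contra ngf => /eqP eq_s;
    rewrite -dvdp_size_eqp // eq_s.
have [||s sP def_h] := IHk h => //; first by apply: leq_trans le_fk.
have [||r rP def_g] := IHk g1 => //; first by rewrite eq_size_g; apply: leq_trans le_fk.
exists (s ++ r); last by rewrite big_cat /= -def_h -def_g.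
by move=> u; rewrite mem_cat => /orP[/sP|/rP].
Qed.

(** * Monic polynomials of degree [n] as tuples of coefficients *)

Section MonicOfTuple.
Variables (A : comNzRingType) (n : nat).
Implicit Types a : n.-tuple A.

Lemma size_monic_of_tuple a : size (monic_of_tuple a) = n.+1.
Proof. by rewrite size_polyDl size_polyXn // ltnS size_poly. Qed.

Lemma monic_of_tuple_monic a : monic_of_tuple a \is monic.
Proof.
rewrite monicE lead_coefE size_monic_of_tuple coefD coefXn eqxx coef_poly.
by rewrite ltnn addr0.
Qed.

Lemma coef_monic_of_tuple a (i : 'I_n) : (monic_of_tuple a)`_i = tnth a i.
Proof. by rewrite coefD coefXn ltn_eqF // coef_poly ltn_ord add0r -tnth_nth. Qed.

Lemma monic_of_tuple_inj : injective (@monic_of_tuple A n).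
Proof.
by move=> a b eq_ab; apply: eq_from_tnth => i; rewrite -!coef_monic_of_tuple eq_ab.
Qed.

Lemma monic_of_tupleP (f : {poly A}) :
  f \is monic -> size f = n.+1 -> exists a, f = monic_of_tuple a.
Proof.
move=> f_mon f_size; exists [tuple f`_i | i < n]; apply/polyP => i.
rewrite coefD coefXn coef_poly; have [lt_in|le_ni] := ltnP i n.
  by rewrite ltn_eqF // add0r (nth_map (Ordinal lt_in)) ?size_enum_ord // nth_enum_ord.
rewrite addr0; case: eqP => [->|/eqP neq_in].
  by move: f_mon; rewrite monicE lead_coefE f_size => /eqP.
by rewrite nth_default // f_size ltn_neqAle eq_sym neq_in.
Qed.

End MonicOfTuple.

Lemma map_monic_of_tuple (A B : comNzRingType) (n : nat) (phi : {rmorphism A -> B})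
    (a : n.-tuple A) :
  map_poly phi (monic_of_tuple a) = monic_of_tuple (map_tuple phi a).
Proof.
rewrite rmorphD /= map_polyXn; congr (_ + _); apply/polyP => i.
rewrite coef_map !coef_poly; case: ltnP => [lt_in|_]; last by rewrite raddf0.
by rewrite (nth_map 0) // size_tuple.
Qed.

(** Used for a fixed tuple of roots, which determines both the polynomial with these roots and the
    permutation through which Frobenius acts on them. *)
Lemma card_eq_subsingleton (S T : finType) (A : {pred S}) (B : {pred T}) :
    {in A &, forall x y, x = y} -> {in B &, forall x y, x = y} ->
    ((exists x, x \in A) <-> (exists y, y \in B)) -> #|A| = #|B|.
Proof.
move=> A1 B1 AB; case: (pickP A) => [x xA|A0].
  have [y yB] : exists y, y \in B by apply/AB; exists x.
  have card1_mem (U : finType) (C : {pred U}) u : u \in C ->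
      {in C &, forall v w, v = w} -> #|C| = 1%N.
    move=> uC C1; rewrite -(card1 u); apply: eq_card => v; rewrite !inE.
    by apply/idP/eqP => [vC|->//]; apply: C1.
  by rewrite (card1_mem _ _ _ xA A1) (card1_mem _ _ _ yB B1).
case: (pickP B) => [y yB|B0]; last by rewrite (eq_card0 A0) (eq_card0 B0).
have [x xA] : exists x, x \in A by apply/AB; exists y.
by have /negP[] := negbT (A0 x).
Qed.

Section Counting.
Variables (F : finFieldType) (n : nat).

Definition sqfree_tuples (mu : seq nat) : {set n.-tuple F} :=
  [set t | `[< squarefree_poly (monic_of_tuple t) /\
               has_splitting_type mu (monic_of_tuple t) >]].

Section SplittingField.
Variables (L : finFieldType) (iota : {rmorphism F -> L}).
Local Notation q := #|F|.
Local Notation "p ^i" := (map_poly iota p) (at level 2, format "p ^i").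

Hypothesis monic_splits : forall t : n.-tuple F,
  exists r, (monic_of_tuple t)^i = \prod_(z <- r) ('X - z%:P).

(** Squarefreeness over [F] implies separability. The minimal polynomial [g] of a double root [z]
    divides [f]; since [z] is a simple root of [g], it is still a root of [f %/ g], so [g ^+ 2]
    divides [f]. *)
Lemma squarefree_uniq_roots (f : {poly F}) (r : seq L) :
  squarefree_poly f -> f^i = \prod_(z <- r) ('X - z%:P) -> uniq r.
Proof.
move=> sqf fr; apply: contraT => /(uniqPn 0)[i [j [lt_ij lt_jr eq_z]]].
have lt_ir := ltn_trans lt_ij lt_jr; set z := r`_j in eq_z.
have z2 : ('X - z%:P) ^+ 2 %| f^i.
  rewrite fr (big_nth 0) big_mkord (bigD1 (Ordinal lt_ir)) //=.
  rewrite (bigD1 (Ordinal lt_jr)) /=; last by rewrite -val_eqE /= gtn_eqF.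
  by rewrite eq_z mulrA expr2 dvdp_mulIl.
have [g gE g_mon] := conjugates_poly iota z.
have gdvd (h : {poly F}) : root h^i z -> g %| h.
  move=> hz; rewrite -(dvdp_map iota) gE dvdp_conjugates ?fingraph.orbit_uniq // => w.
  exact: root_conjugates.
have gf : g %| f by apply: gdvd; rewrite -dvdp_XsubCl; apply: dvdp_trans z2;
  rewrite expr2 dvdp_mulIl.
have := fingraph.orbit_uniq (frobq F (L:=L)) z.
move: (gE); rewrite /fingraph.orbit -orderSpred /= big_cons.
set r' := traject _ _ _ => gE' /andP[zr' _].
have gh : g %| f %/ g.
  apply: gdvd; move: z2; rewrite -{1}(divpK gf) rmorphM /= gE' mulrCA expr2.
  rewrite dvdp_mul2l ?polyXsubC_eq0 // dvdp_XsubCl rootM => /orP[//|].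
  by rewrite root_prod_XsubC (negPf zr').
have : g ^+ 2 %| f by rewrite -(divpK gf) expr2 dvdp_mul2r ?monic_neq0.
by move=> /sqf; rewrite -(size_map_poly iota) gE size_prod_XsubC /fingraph.orbit
  size_traject -orderSpred.
Qed.

Lemma squarefree_root_poly (f : {poly F}) (r : seq L) :
    squarefree_poly f -> f^i = \prod_(z <- r) ('X - z%:P) -> size r = n ->
  exists2 x : {ffun 'I_n -> L}, injective x & f^i = root_poly x.
Proof.
move=> sqf rE r_size; have r_uniq := squarefree_uniq_roots sqf rE.
exists [ffun a : 'I_n => r`_a].
  move=> a b; rewrite !ffunE => /eqP; rewrite nth_uniq ?r_size // => /eqP.
  exact: val_inj.
by rewrite rE (big_nth 0) big_mkord r_size; apply: eq_bigr => a _; rewrite ffunE.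
Qed.

Lemma sqfree_tuple_roots (t : n.-tuple F) : squarefree_poly (monic_of_tuple t) ->
  exists2 x : {ffun 'I_n -> L}, injective x & (monic_of_tuple t)^i = root_poly x.
Proof.
move=> sqt; have [r rE] := monic_splits t; apply: (squarefree_root_poly sqt rE).
by apply/eqP; rewrite -eqSS -(size_prod_XsubC r id) -rE size_map_poly
  size_monic_of_tuple.
Qed.

(** The symmetric group acts simply transitively on the orderings of [n] distinct roots. *)
Lemma card_root_orderings (t : n.-tuple F) : squarefree_poly (monic_of_tuple t) ->
  #|[set x : {ffun 'I_n -> L} | injectiveb x &
      (monic_of_tuple t)^i == root_poly x]| = n`!.
Proof.
move=> /sqfree_tuple_roots[x x_inj xE].
pose g (s : 'S_n) : {ffun 'I_n -> L} := [ffun a => x (s a)].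
have g_inj : injective g.
  move=> s s' /ffunP eq_g; apply/permP => a.
  by have := eq_g a; rewrite !ffunE => /x_inj.
rewrite -card_Sn -(card_imset _ g_inj); apply: eq_card => y; rewrite inE.
apply/andP/imsetP => [[/injectiveP y_inj /eqP yE]|[s _ ->]].
  have /fin_all_exists[s sP] a : exists b, y a = x b.
    by apply/root_root_poly; rewrite -xE yE; apply/root_root_poly; exists a.
  have s_inj : injective s by move=> a b eq_s; apply: y_inj; rewrite !sP eq_s.
  by exists (perm s_inj) => //; apply/ffunP => a; rewrite ffunE permE.
split; first by apply/injectiveP => a b; rewrite !ffunE => /x_inj/perm_inj.
apply/eqP; rewrite xE /root_poly (reindex_inj (@perm_inj _ s)).
by apply: eq_bigr => a _; rewrite ffunE.
Qed.

Lemma root_poly_frob_perm (f : {poly F}) (x : {ffun 'I_n -> L}) :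
  injective x -> f^i = root_poly x -> exists s, x \in frob_tuples L q s.
Proof.
move=> x_inj xE; have /fin_all_exists[s sP] a : exists b, frobq F (x a) = x b.
  apply/root_root_poly; rewrite -xE; apply: root_frobq.
  by rewrite xE; apply/root_root_poly; exists a.
have s_inj : injective s.
  by move=> a b eq_s; apply/x_inj/(@frobq_inj _ _ iota); rewrite !sP eq_s.
by exists (perm s_inj); apply/frob_tuplesP => a; rewrite permE -sP.
Qed.

Lemma frob_tuples_descends s (x : {ffun 'I_n -> L}) : x \in frob_tuples L q s ->
  exists t : n.-tuple F, (monic_of_tuple t)^i = root_poly x.
Proof.
move=> /frob_tuplesP xs.
have [|g gE] := @prod_XsubC_descends _ _ iota [seq x a | a <- enum 'I_n].
  rewrite -map_comp (eq_map (g := x \o s)) => [|a]; last by rewrite /= -xs.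
  rewrite map_comp; apply/perm_map/uniq_perm;
    rewrite ?(map_inj_uniq (@perm_inj _ s)) ?enum_uniq //.
  move=> a; rewrite mem_enum; apply/mapP; exists (s^-1%g a); rewrite ?mem_enum //.
  by rewrite permKV.
have g_root : g^i = root_poly x by rewrite gE big_map big_enum.
have g_mon : g \is monic by rewrite -(map_monic iota) gE monic_prod_XsubC.
have g_size : size g = n.+1.
  by rewrite -(size_map_poly iota) gE size_prod_XsubC size_map size_enum_ord.
by have [t def_g] := monic_of_tupleP g_mon g_size; exists t; rewrite -def_g.
Qed.

(** Double count of pairs: the left side groups injective root tuples by their polynomial, the right
    side by the permutation that Frobenius induces. *)
Lemma card_sqfree_tuples mu :
  (#|sqfree_tuples mu| * n`! =
     \sum_(s in perm_class n mu) #|[set x in frob_tuples L q s | injectiveb x]|)%N.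
Proof.
pose P (t : n.-tuple F) (x : {ffun 'I_n -> L}) :=
  injectiveb x && ((monic_of_tuple t)^i == root_poly x).
pose Q (s : 'S_n) (x : {ffun 'I_n -> L}) := (x \in frob_tuples L q s) && injectiveb x.
transitivity (\sum_(t in sqfree_tuples mu) \sum_(x | P t x) 1)%N.
  rewrite -sum_nat_const; apply: eq_bigr => t; rewrite inE => /asboolP[sqt _].
  by rewrite -(card_root_orderings sqt) -sum1_card; apply: eq_bigl => x; rewrite !inE.
transitivity (\sum_(s in perm_class n mu) \sum_(x | Q s x) 1)%N; last first.
  by apply: eq_bigr => s _; rewrite -sum1_card; apply: eq_bigl => x; rewrite inE.
rewrite (exchange_big_dep predT) //= [RHS](exchange_big_dep predT) //=.
apply: eq_bigr => x _; rewrite !sum1_card; apply: card_eq_subsingleton.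
- move=> t u /andP[_ /andP[_ /eqP tx]] /andP[_ /andP[_ /eqP ux]].
  by apply/monic_of_tuple_inj/(map_poly_inj iota); rewrite tx.
- move=> s s' /andP[_ /andP[/frob_tuplesP sx /injectiveP x_inj]].
  move=> /andP[_ /andP[/frob_tuplesP s'x _]]; apply/permP => a; apply: x_inj.
  by rewrite -sx -s'x.
split=> [[t]|[s]]; rewrite unfold_in => /andP[].
  rewrite inE => /asboolP[sqt t_mu] /andP[/injectiveP x_inj /eqP tx].
  have [s xs] := root_poly_frob_perm x_inj tx.
  exists s; rewrite unfold_in /Q xs (introT (injectiveP _) x_inj) andbT andbT.
  exact: splitting_type_perm_class x_inj xs tx t_mu.
move=> s_mu /andP[xs /injectiveP x_inj]; have [t tx] := frob_tuples_descends xs.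
exists t; rewrite unfold_in /P tx eqxx (introT (injectiveP _) x_inj) !andbT inE.
apply/asboolP; split; first exact: root_poly_squarefree x_inj tx.
(* The polynomial has some splitting type; by the previous correspondence it is the cycle type of
   [s], which is [mu]. *)
have [r rP def_t] := monic_irreducible_factorization (monic_of_tuple_monic t).
suff -> : mu = sort geq [seq (size g).-1 | g : {poly F} <- r] by exists r.
have : s \in perm_class n (sort geq [seq (size g).-1 | g : {poly F} <- r]).
  by apply: splitting_type_perm_class x_inj xs tx _; exists r.
by move: s_mu; rewrite !inE => /eqP<- /eqP.
Qed.

End SplittingField.

End Counting.

Lemma dvdp_splits (L : fieldType) (f P : {poly L}) (r : seq L) :
    f \is monic -> f %| P -> P %= \prod_(z <- r) ('X - z%:P) ->
  exists r, f = \prod_(z <- r) ('X - z%:P).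
Proof.
move=> f_mon fP Pr; have [|m fE] := @dvdp_prod_XsubC _ _ r id f;
  first by rewrite -(eqp_dvdr _ Pr).
by exists (mask m r); apply/eqP; rewrite -eqp_monic ?monic_prod_XsubC.
Qed.

Lemma finite_splitting_field (F : finFieldType) (P : {poly F}) : P != 0 ->
  exists (L : finFieldType) (iota : {rmorphism F -> L}) (r : seq L),
    map_poly iota P %= \prod_(z <- r) ('X - z%:P).
Proof.
move=> P_neq0; have [L0 [r rP _]] := FinSplittingFieldFor P_neq0.
pose L : finFieldType := FinFieldExtType L0.
by exists L, (in_alg L0 : {rmorphism F -> L}), r.
Qed.

(** With [Q = q ^ i], the polynomial [X^Q - X] splits in [L], and its derivative is [-1] because [Q]
    vanishes in [L]; so it has [Q] distinct roots. *)
Lemma card_frob_fixed (F L : finFieldType) (iota : {rmorphism F -> L}) (i : nat) (P :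
  {poly F}) (r : seq L) :
    (0 < i)%N -> 'X^(#|F| ^ i) - 'X %| P ->
    map_poly iota P %= \prod_(z <- r) ('X - z%:P) ->
  #|[set y : L | y ^+ (#|F| ^ i) == y]| = (#|F| ^ i)%N.
Proof.
move=> i_gt0 fP Pr; set Q := (#|F| ^ i)%N.
have F_gt1 : (1 < #|F|)%N := finNzRing_gt1 F.
have Q_gt1 : (1 < Q)%N by rewrite -(expn0 #|F|) ltn_exp2l.
pose f : {poly L} := 'X^Q - 'X.
have f_size : size f = Q.+1 by rewrite size_polyDl ?size_polyXn // size_polyN
  size_polyX.
have f_mon : f \is monic.
  by rewrite monicE lead_coefE f_size /= coefB coefXn eqxx coefX gtn_eqF // subr0.
have [|s fs] := dvdp_splits f_mon _ Pr.
  by rewrite -[f](_ : map_poly iota ('X^Q - 'X) = f) ?dvdp_map // rmorphB /=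
    map_polyXn map_polyX.
have Q0 : Q%:R = 0 :> L.
  have [p p_pr charLp] := finPcharP L; apply/eqP; rewrite -(dvdn_pcharf charLp).
  have := pchar_nat_card iota; rewrite (eq_pnat _ (pcharf_eq charLp)) => /p_natP[e FE].
  rewrite /Q FE; apply: dvdn_exp => //; case: e FE => [F1|e _];
    last by rewrite expnS dvdn_mulr.
  by rewrite F1 expn0 in F_gt1.
have s_uniq : uniq s.
  rewrite -separable_prod_XsubC -fs unlock.
  rewrite derivB derivXn derivX -mulr_natl -polyC_natr Q0 mul0r sub0r.
  by rewrite -scaleN1r coprimepZr ?oppr_eq0 ?oner_eq0 ?coprimep1.
have s_size : size s = Q by apply/eqP; rewrite -eqSS -(size_prod_XsubC s id) -fs f_size.
rewrite -[RHS]s_size -(card_uniqP s_uniq); apply: eq_card => y; rewrite inE.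
by rewrite -root_prod_XsubC -fs rootE !hornerE subr_eq0.
Qed.

Section Bounds.
Variables (F : finFieldType) (n : nat) (mu : seq nat).
Local Notation q := #|F|.

Lemma card_sqfree_tuples_bounds :
  (#|sqfree_tuples F n mu| * n`! <= #|perm_class n mu| * q ^ n)%N /\
  (#|perm_class n mu| * q ^ n * q <=
     #|sqfree_tuples F n mu| * n`! * q + #|perm_class n mu| * (n ^ 2 * q ^ n))%N.
Proof.
have q_gt1 : (1 < q)%N := finNzRing_gt1 F.
(* The splitting field of this product serves for everything at once: all monic polynomials of
   degree [n] split there, and so do the [X^(q^i) - X] for [0 < i <= n]. *)
pose P : {poly F} := (\prod_(t : n.-tuple F) monic_of_tuple t) *
  \prod_(i < n) ('X^(q ^ i.+1) - 'X).
have XqX_neq0 (i : 'I_n) : 'X^(q ^ i.+1) - 'X != 0 :> {poly F}.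
  have Q_gt1 : (1 < q ^ i.+1)%N by rewrite -{1}(expn0 q) ltn_exp2l.
  by rewrite -size_poly_gt0 size_polyDl size_polyXn // size_polyN size_polyX.
have P_neq0 : P != 0.
  rewrite mulf_neq0 //; apply/prodf_neq0 => // t _.
  exact/monic_neq0/monic_of_tuple_monic.
have [L [iota [r Pr]]] := finite_splitting_field P_neq0.
have fixed i : (0 < i <= n)%N -> #|[set y : L | y ^+ (q ^ i) == y]| = (q ^ i)%N.
  case: i => // i /= lt_in; apply: (card_frob_fixed _ _ Pr) => //.
  by rewrite dvdp_mull // (bigD1 (Ordinal lt_in)) //= dvdp_mulr.
have splits (t : n.-tuple F) :
    exists r, map_poly iota (monic_of_tuple t) = \prod_(z <- r) ('X - z%:P).
  apply: dvdp_splits Pr; first by rewrite map_monic monic_of_tuple_monic.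
  by rewrite dvdp_map dvdp_mulr // (bigD1 t) //= dvdp_mulr.
have frobB (x y : L) : (x - y) ^+ q = x ^+ q - y ^+ q := frobq_zmod_morphism iota x y.
rewrite (card_sqfree_tuples splits); split.
  rewrite -sum_nat_const; apply: leq_sum => s _.
  rewrite -(card_frob_tuples fixed s).
  by apply/subset_leq_card/fintype.subsetP => x; rewrite inE => /andP[].
rewrite big_distrl /= -[X in (X <= _)%N]mulnA -!sum_nat_const -big_split /=;
  apply: leq_sum => s _.
exact: card_frob_tuples_inj.
Qed.

End Bounds.

(** * Existence of permutations with a given cycle type *)

Section CycleTypeExists.
Variable mu : seq nat.
Hypothesis mu_gt0 : all (leq 1) mu.
Local Notation k := (size mu).
Local Notation m i := (nth 0%N mu i).

(** A disjoint union of cyclic sets, one for each part of [mu]; rotating every summand gives a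
    permutation of cycle type [mu], to be transported to ['I_n] by an enumeration. *)
Definition cycles_type : finType := {i : 'I_k & 'I_(m i)}.

Definition cycles_fun (u : cycles_type) : cycles_type :=
  Tagged (fun i : 'I_k => 'I_(m i)) (ordS (tagged u)).

Lemma cycles_fun_inj : injective cycles_fun.
Proof.
move=> [i u] [j v] /eqP; rewrite -tag_eqE /tag_eq /= => /andP[/eqP eq_ij].
case: _ / eq_ij v => v; rewrite tagged_asE => /eqP/ordS_inj eq_uv.
by apply/eqP; rewrite -tag_eqE /tag_eq /= eqxx tagged_asE eq_uv eqxx.
Qed.

Definition cycles_perm := perm cycles_fun_inj.

Lemma cycles_permX j (i : 'I_k) (u : 'I_(m i)) :
  exists v : 'I_(m i), (cycles_perm ^+ j)%g (Tagged (fun i : 'I_k => 'I_(m i)) u) =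
    Tagged (fun i : 'I_k => 'I_(m i)) v /\ v = ((u + j) %% m i)%N :> nat.
Proof.
elim: j => [|j [v [IHj vE]]].
  by exists u; rewrite perm1 addn0 modn_small.
exists (ordS v); rewrite expgSr permM IHj permE; split=> //=.
by rewrite vE addnS -addn1 modnDml addn1.
Qed.

Lemma porbit_cycles_perm (u : cycles_type) :
  porbit cycles_perm u = [set v | tag v == tag u].
Proof.
case: u => i u; apply/setP => -[j v]; rewrite inE /=.
apply/porbitP/eqP => [[l]|eq_ji].
  by have [w [-> _]] := cycles_permX l u; move=> /(congr1 tag).
case: _ / (esym eq_ji) v => v; exists (v + (m i - u))%N.
have [w [-> wE]] := cycles_permX (v + (m i - u))%N u; congr (Tagged _ _).
apply: val_inj; rewrite /= wE addnCA subnKC ?modnDr ?modn_small //.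
exact: ltnW.
Qed.

Lemma card_cycles_type : #|{: cycles_type}| = sumn mu.
Proof.
rewrite card_tagged (eq_map (g := fun i : 'I_k => m i)) => [|i]; last exact: card_ord.
by rewrite -[in RHS](mkseq_nth 0%N mu) /mkseq -val_enum_ord -map_comp.
Qed.

(** Makes [nu_sym] positive, without which the strict inequalities of the theorem would fail. *)
Lemma perm_class_gt0 n : sorted geq mu -> sumn mu = n -> (0 < #|perm_class n mu|)%N.
Proof.
move=> mu_sorted mu_sum.
have card_n : #|{: cycles_type}| = n by rewrite card_cycles_type.
pose e (a : 'I_n) : cycles_type := enum_val (cast_ord (esym card_n) a).
pose e' (u : cycles_type) : 'I_n := cast_ord card_n (enum_rank u).
have eK : cancel e e' by move=> a; rewrite /e /e' enum_valK cast_ordKV.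
have e'K : cancel e' e by move=> u; rewrite /e /e' cast_ordK enum_rankK.
have s_inj : injective (e' \o cycles_perm \o e).
  exact: inj_comp (inj_comp (can_inj e'K) (@perm_inj _ _)) (can_inj eK).
pose s := perm s_inj.
have sX j a : (s ^+ j)%g a = e' ((cycles_perm ^+ j)%g (e a)).
  elim: j => [|j IHj]; first by rewrite !perm1 eK.
  by rewrite !expgSr !permM IHj permE /= e'K.
have porbit_s a : porbit s a = [set b | tag (e b) == tag (e a)].
  apply/setP => b; have -> : (b \in [set b | tag (e b) == tag (e a)]) = (e b \in
    porbit cycles_perm (e a)).
    by rewrite porbit_cycles_perm !inE.
  apply/porbitP/porbitP => -[j def_b]; exists j.
    by rewrite def_b sX e'K.
  by rewrite sX -def_b eK.
pose Z (i : 'I_k) := [set b : 'I_n | tag (e b) == i].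
have m_gt0 (i : 'I_k) : (0 < m i)%N by apply: (allP mu_gt0); apply: mem_nth.
pose z (i : 'I_k) : 'I_n := e' (Tagged (fun i : 'I_k => 'I_(m i)) (Ordinal (m_gt0 i))).
have zZ i : tag (e (z i)) = i by rewrite e'K.
pose g (i : 'I_k) (u : 'I_(m i)) : 'I_n := e' (Tagged (fun i : 'I_k => 'I_(m i)) u).
have cardZ i : #|Z i| = m i.
  rewrite -[RHS]card_ord -(@card_imset _ _ (g i)).
    apply: eq_card => b; rewrite inE; apply/eqP/imsetP => [<-|[u _ ->]];
      last by rewrite e'K.
    exists (tagged (e b)) => //; rewrite -[LHS]eK /g; congr e'.
    by case: (e b).
  move=> u v /(can_inj e'K)/eqP; rewrite -tag_eqE /tag_eq /= eqxx tagged_asE.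
  exact/eqP.
apply/card_gt0P; exists s; rewrite inE -[X in _ == X](sorted_sort (leT := geq)) //;
  last first.
  by move=> a b c /= le_ab le_ca; apply: leq_trans le_ab.
apply/eqP/perm_sortP.
- by move=> a b; apply: leq_total.
- by move=> a b c /= le_ab le_ca; apply: leq_trans le_ab.
- by move=> a b; rewrite /= andbC -eqn_leq => /eqP.
have -> : mu = [seq #|c| | c : {set 'I_n} <- map Z (enum 'I_k)].
  rewrite -map_comp (eq_map (g := fun i : 'I_k => m i)) => [|i]; last exact: cardZ.
  by rewrite -[LHS](mkseq_nth 0%N mu) /mkseq -val_enum_ord -map_comp.
have Z_inj : injective Z.
  by move=> i j /setP/(_ (z i)); rewrite !inE zZ eqxx => /esym/eqP.
apply/perm_map/uniq_perm; rewrite ?(map_inj_uniq Z_inj) ?enum_uniq //.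
move=> c; rewrite mem_enum; apply/imsetP/mapP => [[a _ ->]|[i _ ->]].
  by exists (tag (e a)); rewrite ?mem_enum ?porbit_s.
by exists (z i); rewrite ?porbit_s ?zZ.
Qed.

End CycleTypeExists.

(** * Idempotents modulo a monic polynomial over the p-adic integers *)

Section PadicIdempotent.
Local Notation rdivp := Pdiv.Ring.rdivp.
Local Notation rmodp := Pdiv.Ring.rmodp.
Variables (p : nat) (p_pr : prime p).
Local Notation Zp := (padic_integer p_pr).
Implicit Types (x y z : Zp) (A B M : {poly Zp}).

Lemma padic_natr m : m%:R = padic_nat p_pr m :> Zp.
Proof.
elim: m => [//|m IHm]; rewrite -natr1 IHm; apply: padic_inj => k /=.
by rewrite modnDm addn1.
Qed.

Lemma val_padic_natr m k : val (m%:R : Zp) k = (m %% p ^ k)%N.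
Proof. by rewrite padic_natr. Qed.

Lemma padic_val_sub x y k : (val (x - y) k == 0%N) = (val x k == val y k).
Proof.
have -> : val (x - y) k = ((val x k + (p ^ k - val y k)) %% p ^ k)%N by rewrite /=
  modnDmr.
have yk := ltnW (padic_lt y k).
rewrite -[in RHS](padic_small x) -[in RHS](padic_small y) -(mod0n (p ^ k)).
rewrite -(eqn_modDr (val y k)) -addnA subnK // add0n.
by rewrite -modnDmr modnn addn0.
Qed.

Lemma padic_val_dvd x k : val x k = 0%N -> exists z, x = p%:R ^+ k * z.
Proof.
move=> xk0.
have pk_gt0 j : (0 < p ^ j)%N by rewrite expn_gt0 prime_gt0.
have dvd_x m : (p ^ k %| val x (m + k))%N.
  by rewrite /dvdn -padic_mod ?leq_addl // xk0.
(* Division by [p ^ k] loses [k] digits, so the residue of the quotient modulo [p ^ m] is read off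
   from [x] modulo [p ^ (m + k)]. *)
have coh m : (val x (m.+1 + k) %/ p ^ k = val x (m + k) %/ p ^ k %[mod p ^ m])%N.
  apply/eqP; rewrite -(eqn_pmul2r (pk_gt0 k)) !muln_modl // -expnD !divnK //.
  by rewrite addSn padic_modS.
exists (padic_mk p_pr coh); apply: padic_inj => m.
rewrite -natrX /= val_padic_natr /= modnMml -modnMmr modn_mod modnMmr mulnC divnK;
  last exact: dvd_x.
by rewrite -padic_mod // leq_addr.
Qed.

Lemma padic_val_mul_exp k z : val (p%:R ^+ k * z) k = 0%N.
Proof. by rewrite -natrX /= val_padic_natr modnn mul0n mod0n. Qed.

Lemma padic_natr_eq0 m : (m%:R == 0 :> Zp) = (m == 0%N).
Proof.
apply/eqP/eqP => [/(congr1 (fun x : Zp => val x m))|->//].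
rewrite val_padic_natr /= mod0n modn_small //.
by rewrite ltn_expl // prime_gt1.
Qed.

Section Congruence.
Variable M : {poly Zp}.
Hypothesis M_mon : M \is monic.

(** Congruence modulo the ideal generated by [p ^ k] and [M], that is, equality in the finite ring
    of polynomials over [Z/p^k] modulo [M]. *)
Definition eqmodp k A B := exists G Q, A - B = (p%:R ^+ k)%:P * G + Q * M.

Lemma eqmodp_refl k A : eqmodp k A A.
Proof. by exists 0, 0; rewrite subrr mulr0 mul0r addr0. Qed.

Lemma eqmodp_sym k A B : eqmodp k A B -> eqmodp k B A.
Proof. by move=> [G [Q e]]; exists (- G), (- Q); rewrite -opprB e; ring. Qed.

Lemma eqmodp_trans k A B C : eqmodp k A B -> eqmodp k B C -> eqmodp k A C.
Proof.
move=> [G [Q e]] [G' [Q' e']]; exists (G + G'), (Q + Q').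
by rewrite -(subrK B A) -addrA e e'; ring.
Qed.

Lemma eqmodpM k A B C D : eqmodp k A B -> eqmodp k C D -> eqmodp k (A * C) (B * D).
Proof.
move=> [G [Q e]] [G' [Q' e']]; exists (G * C + B * G'), (Q * C + B * Q').
have -> : A * C - B * D = (A - B) * C + B * (C - D) by ring.
by rewrite e e'; ring.
Qed.

Lemma eqmodp_le k l A B : (k <= l)%N -> eqmodp l A B -> eqmodp k A B.
Proof.
move=> /subnK <- [G [Q e]]; exists ((p%:R ^+ (l - k))%:P * G), Q.
by rewrite e exprD polyCM mulrA [(_ ^+ _)%:P * _]mulrC.
Qed.

Lemma eqmodp_rmodp k A : eqmodp k (rmodp A M) A.
Proof.
exists 0, (- rdivp A M).
have := Pdiv.RingMonic.rdivp_eq M_mon A.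
by move: (rdivp A M) (rmodp A M) => d r ->; ring.
Qed.

Lemma eqmodp_coef k A B : (size A < size M)%N -> (size B < size M)%N ->
  eqmodp k A B -> forall i, val A`_i k = val B`_i k.
Proof.
move=> szA szB [G [Q e]] i; apply/eqP; rewrite -padic_val_sub; apply/eqP.
rewrite -coefB -(Pdiv.Ring.rmodp_small (q := M) (p := A - B)); last first.
  by apply: leq_ltn_trans (size_polyD _ _) _; rewrite size_polyN gtn_max szA.
rewrite e Pdiv.RingMonic.rmodpD // Pdiv.RingMonic.rmodp_mull // addr0 mul_polyC.
by rewrite Pdiv.RingMonic.rmodpZ // coefZ padic_val_mul_exp.
Qed.

Lemma eqmodp_of_coef k A B : (forall i, val A`_i k = val B`_i k) -> eqmodp k A B.
Proof.
move=> eq_AB; have /choice[z zP] i : exists z, (A - B)`_i = p%:R ^+ k * z.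
  by apply: padic_val_dvd; apply/eqP; rewrite coefB padic_val_sub eq_AB.
exists (\poly_(i < size (A - B)) z i), 0; rewrite mul0r addr0 mul_polyC.
apply/polyP => i; rewrite coefZ coef_poly; case: ltnP => [_|le_i]; first exact: zP.
by rewrite mulr0 nth_default.
Qed.

(** Pigeonhole: the remainders modulo [M] with coefficients taken modulo [p ^ k] form a finite set
    [T], so two of the first [#|T| + 1] powers of [X] agree. *)
Lemma eqmodp_Xn_periodic k : exists i t, (0 < t)%N /\ eqmodp k 'X^i 'X^(i + t).
Proof.
pose T := {ffun 'I_(size M) -> 'I_(p ^ k)}.
pose g (j : 'I_(#|T|).+1) : T := [ffun i : 'I_(size M) => Ordinal (padic_lt (rmodp
  'X^j M)`_i k)].
have /injectivePn[a [b neq_ab eq_g]] : ~~ injectiveb g.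
  by apply/injectiveP => /leq_card; rewrite card_ord ltnn.
wlog lt_ab : a b neq_ab eq_g / (a < b)%N.
  move=> IH; case: (ltngtP a b) => [|lt_ba|/val_inj eq_ab]; first exact: IH.
    by apply: (IH b a); rewrite 1?eq_sym.
  by rewrite eq_ab eqxx in neq_ab.
exists a, (b - a)%N; rewrite subn_gt0 lt_ab; split=> //;
  rewrite subnKC ?(ltnW lt_ab) //.
apply: eqmodp_trans (eqmodp_sym (eqmodp_rmodp k _)) _.
apply: eqmodp_trans _ (eqmodp_rmodp k _); apply: eqmodp_of_coef => i.
have M_neq0 := monic_neq0 M_mon.
have [lt_i|le_i] := ltnP i (size M).
  by have /ffunP/(_ (Ordinal lt_i)) := eq_g; rewrite !ffunE => /(congr1 val).
by rewrite !nth_default // (leq_trans _ le_i) // ltnW // Pdiv.Ring.ltn_rmodpN0.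
Qed.

(** From exponent [i] on, the powers of [X] have period [t]. For [r = max(i, t)] and [s >= r], both
    factorials are at least [i] and divisible by [t], so adding [r!] or [s! - r!] to the exponent
    [r!] changes nothing. *)
Lemma eqmodp_Xn_fact k : exists r, eqmodp k ('X^(r`!) ^+ 2) 'X^(r`!) /\
  forall s, (r <= s)%N -> eqmodp k 'X^(s`!) 'X^(r`!).
Proof.
have [i [t [t_gt0 per]]] := eqmodp_Xn_periodic k.
have perM j m : eqmodp k 'X^(i + j + t * m) 'X^(i + j).
  elim: m => [|m IHm]; first by rewrite muln0 addn0; apply: eqmodp_refl.
  apply: eqmodp_trans IHm; apply: eqmodp_sym.
  have -> : 'X^(i + j + t * m) = 'X^i * 'X^(j + t * m) :> {poly Zp} by rewrite -exprD
    addnA.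
  have -> : 'X^(i + j + t * m.+1) = 'X^(i + t) * 'X^(j + t * m) :> {poly Zp}.
    by rewrite -exprD; congr ('X^_); rewrite mulnS; lia.
  by apply: eqmodpM per _; apply: eqmodp_refl.
pose r := maxn i t; have le_i : (i <= r`!)%N by rewrite (leq_trans (leq_maxl i t))
  ?fact_geq.
have dvd_t s : (r <= s)%N -> (t %| s`!)%N.
  by move=> le_rs; rewrite dvdn_fact // t_gt0 (leq_trans (leq_maxr i t)).
have perF a : (t %| a)%N -> eqmodp k 'X^(r`! + a) 'X^(r`!).
  by move=> /dvdnP[m ->]; rewrite mulnC -{1 2}(subnKC le_i); apply: perM.
exists r; split; first by rewrite -exprM muln2 -addnn; apply/perF/dvd_t.
move=> s le_rs; rewrite -(subnKC (_ : r`! <= s`!)%N) ?leq_fact //.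
by apply/perF/dvdn_sub; apply: dvd_t.
Qed.

(* The idempotent is the limit of [X^(r!)] modulo [M]: in the finite ring of
   polynomials modulo [p^k] and [M] this sequence is eventually constant, with
   idempotent value. *)
Lemma padic_idempotent : exists E : {poly Zp},
  (exists Q, E ^+ 2 - E = Q * M) /\
  (exists j G Q, (0 < j)%N /\ E - 'X^j = p%:R%:P * G + Q * M).
Proof.
have /choice[r rP] := eqmodp_Xn_fact.
pose rho k : {poly Zp} := rmodp 'X^((r k)`!) M.
have M_neq0 := monic_neq0 M_mon.
have rho_size k : (size (rho k) < size M)%N by apply: Pdiv.Ring.ltn_rmodpN0.
(* The limit is taken coefficientwise; the remainders at levels [k] and [k + 1] are compared through
   [X^(s!)] with [s] the larger of [r k] and [r k.+1]. *)
have coh i k : val (rho k.+1)`_i k.+1 = val (rho k)`_i k %[mod p ^ k].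
  rewrite padic_modS !padic_small; apply: eqmodp_coef => //.
  apply: eqmodp_trans (eqmodp_rmodp k _) _.
  apply: eqmodp_trans _ (eqmodp_sym (eqmodp_rmodp k _)).
  have [[_ stab] [_ stabS]] := (rP k, rP k.+1).
  apply: eqmodp_trans (stab _ (leq_maxl _ (r k.+1))).
  by apply: (eqmodp_le (leqnSn k)); apply/eqmodp_sym/stabS/leq_maxr.
pose E := \poly_(i < size M) padic_mk p_pr (coh i).
have E_rho k : eqmodp k E 'X^((r k)`!).
  apply: eqmodp_trans (eqmodp_rmodp k _); apply: eqmodp_of_coef => i.
  rewrite coef_poly; case: ltnP => [_|le_i]; first by rewrite /= padic_small.
  by rewrite -/(rho k) [in RHS]nth_default // (leq_trans (ltnW (rho_size k)) le_i).
exists E; split; last first.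
  have [G [Q e]] := E_rho 1%N; rewrite expr1 in e.
  by exists (r 1%N)`!, G, Q; rewrite fact_gt0.
exists (rdivp (E ^+ 2 - E) M).
rewrite {1}(Pdiv.RingMonic.rdivp_eq M_mon (E ^+ 2 - E)) -[RHS]addr0; congr (_ + _).
(* The remainder of [E ^+ 2 - E] vanishes because it is congruent to [0] at every level [k]. *)
apply/polyP => i; apply: padic_inj => k; apply: eqmodp_coef.
- exact: Pdiv.Ring.ltn_rmodpN0.
- by rewrite size_poly0 size_poly_gt0.
apply: eqmodp_trans (eqmodp_rmodp k _) _.
have [G [Q e]] : eqmodp k (E ^+ 2) E.
  apply: eqmodp_trans (eqmodp_sym (E_rho k)); apply: eqmodp_trans (rP k).1.
  by rewrite !expr2; apply: eqmodpM.
by exists G, Q; rewrite subr0.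
Qed.

End Congruence.

End PadicIdempotent.

(** * Reduction of irreducible polynomials *)

Lemma splitting_extension (k : nat) (K : fieldType) (f : {poly K}) :
    (size f <= k)%N -> f \is monic ->
  exists (L : fieldType) (iota : {rmorphism K -> L}) (r : seq L),
    map_poly iota f = \prod_(z <- r) ('X - z%:P).
Proof.
elim: k K f => [|k IHk] K f.
  by rewrite leqn0 size_poly_eq0 => /eqP-> /monic_neq0; rewrite eqxx.
move=> le_fk f_mon; have [[|g s] sP def_f] := monic_irreducible_factorization f_mon.
  by exists K, idfun, [::]; rewrite def_f big_nil rmorph1 big_nil.
have [g_mon g_irr] := sP g (mem_head _ _).
have [L1 _ [z gz _]] := irredp_FAdjoin g_irr.
have fz : root (map_poly (in_alg L1) f) z.
  by rewrite def_f big_cons rmorphM rootM gz.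
have [h def_h] := factor_theorem _ _ fz.
have h_mon : h \is monic.
  by rewrite -(monicMr _ (monicXsubC z)) -def_h map_monic.
have [|L [iota [r hr]]] := IHk L1 h _ h_mon.
  rewrite -ltnS (leq_trans _ le_fk) // -(size_map_poly (in_alg L1) f) def_h.
  by rewrite size_Mmonic ?monicXsubC ?monic_neq0 // size_XsubC addn2.
exists L, (iota \o in_alg L1), (rcons r (iota z)).
by rewrite map_poly_comp def_h rmorphM /= hr map_polyXsubC -cats1 big_cat big_seq1.
Qed.

Lemma irreducible_dvdp_root (K L : fieldType) (iota : {rmorphism K -> L})
    (f g : {poly K}) (z : L) :
  irreducible_poly f -> root (map_poly iota f) z -> root (map_poly iota g) z ->
  f %| g.
Proof.
move=> [_ f_irr] fz gz; have [co_fg|nco_fg] := boolP (coprimep f g).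
  have := co_fg; rewrite -(coprimep_map iota) => /coprimep_root/(_ fz).
  by rewrite -rootE gz.
have eq_f : gcdp f g %= f by apply: f_irr (dvdp_gcdl f g); rewrite -coprimep_def.
by rewrite -(eqp_dvdl _ eq_f) dvdp_gcdr.
Qed.

(** Division by the monic [f] is already possible over [A]; over [K] its remainder is divisible by
    [f] and of smaller degree, hence zero. *)
Lemma monic_dvdp_descends (A : comNzRingType) (K : fieldType)
    (iota : {rmorphism A -> K}) (f g : {poly A}) :
    injective iota -> f \is monic -> map_poly iota f %| map_poly iota g ->
  exists h, g = h * f.
Proof.
move=> iota_inj f_mon fg; exists (Pdiv.Ring.rdivp g f).
rewrite {1}(Pdiv.RingMonic.rdivp_eq f_mon g); set r := Pdiv.Ring.rmodp g f.
suff -> : r = 0 by rewrite addr0.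
have r_size : (size r < size f)%N by rewrite Pdiv.Ring.ltn_rmodpN0 // monic_neq0.
apply: (@map_inj_poly _ _ iota); rewrite ?raddf0 //; apply/eqP; apply: contraLR r_size.
move=> r_neq0; rewrite -leqNgt -(size_map_inj_poly iota_inj (raddf0 _) f).
rewrite -(size_map_inj_poly iota_inj (raddf0 _) r) dvdp_leq //.
move: fg; rewrite {1}(Pdiv.RingMonic.rdivp_eq f_mon g) rmorphD rmorphM /=.
by rewrite dvdp_addr // dvdp_mulIr.
Qed.

Section RingOfIntegers.
Variables (p : nat) (p_pr : prime p) (K : fieldExtType (padic_number p_pr)).
Local Notation Zp := (padic_integer p_pr).
Local Notation O := (ring_of_integers K).

HB.instance Definition _ := GRing.RMorphism.copy (@padic_integer_in p p_pr K)
  (in_alg K \o @FracField.tofrac (padic_integer p_pr)).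

Definition padic_to_integers (z : Zp) : O :=
  exist _ (padic_integer_in K z) (introT (asboolP _) (integral_id _ z)).

Lemma padic_to_integers_zmod : zmod_morphism padic_to_integers.
Proof. by move=> x y; apply: val_inj; rewrite /= rmorphB. Qed.

Lemma padic_to_integers_monoid : monoid_morphism padic_to_integers.
Proof. by split=> [|x y]; apply: val_inj; rewrite /= ?rmorph1 ?rmorphM. Qed.

HB.instance Definition _ := GRing.isZmodMorphism.Build Zp O padic_to_integers
  padic_to_integers_zmod.
HB.instance Definition _ := GRing.isMonoidMorphism.Build Zp O padic_to_integers
  padic_to_integers_monoid.

Lemma integral_prod_XsubC (L : fieldType) (iota : {rmorphism Zp -> L}) (r : seq L) :
    {in r, forall z, integralOver iota z} ->
  forall i, integralOver iota (\prod_(z <- r) ('X - z%:P))`_i.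
Proof.
elim: r => [|z r IHr] r_int i.
  by rewrite big_nil coef1; apply: integral_nat.
have {}IHr j := IHr (fun w wr => r_int w (mem_behead (s := z :: r) wr)) j.
rewrite big_cons mulrBl coefB mul_polyC coefZ coefXM.
apply: integral_sub; last by apply: integral_mul (IHr i); apply: r_int; apply: mem_head.
by case: ifP => _; [exact: (integral_nat _ 0) | exact: IHr].
Qed.

Lemma integral_val (L : fieldType) (iota : {rmorphism K -> L}) (c : O) :
  integralOver (iota \o padic_integer_in K) (iota (val c)).
Proof. exact/integral_rmorph/asboolP/(valP c). Qed.

Lemma integral_descends (L : fieldType) (iota : {rmorphism K -> L}) (c : K) :
  integralOver (iota \o padic_integer_in K) (iota c) -> exists c' : O, c = val c'.
Proof.
move=> [M M_mon Mc]; suff c_int : integers c by exists (Sub c c_int).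
by apply/asboolP; exists M => //; rewrite -(fmorph_root iota) -map_poly_comp.
Qed.

(** A form of Gauss's lemma: the roots of [g] are roots of [f], hence integral, and the coefficients
    of [g] are polynomial expressions in them. *)
Lemma monic_factor_integral (f : {poly O}) (g : {poly K}) :
    f \is monic -> g \is monic -> g %| map_poly val f ->
  exists2 g' : {poly O}, g' \is monic & map_poly val g' = g.
Proof.
move=> f_mon g_mon gf.
have fK_mon : map_poly val f \is monic by apply: monic_map.
have [L [iota [r fr]]] := splitting_extension (leqnn _) fK_mon.
have fL_mon : map_poly iota (map_poly val f) \is monic by rewrite map_monic.
have gL_mon : map_poly iota g \is monic by rewrite map_monic.
have gL_fL : map_poly iota g %| map_poly iota (map_poly val f) by rewrite dvdp_map.
have [|s gs] := dvdp_splits gL_mon gL_fL (r := r); first by rewrite fr eqpxx.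
have s_int : {in s, forall z, integralOver (iota \o padic_integer_in K) z}.
  move=> z; rewrite -root_prod_XsubC -gs => gz.
  apply: (integral_root_monic fL_mon).
    by rewrite -dvdp_XsubCl (dvdp_trans _ gL_fL) ?dvdp_XsubCl.
  by apply/integral_poly => i; rewrite !coef_map; apply: integral_val.
have /choice[c cP] i : exists c : O, g`_i = val c.
  by apply: (@integral_descends _ iota); rewrite -coef_map gs;
    apply: integral_prod_XsubC.
have gE : map_poly val (\poly_(i < size g) c i : {poly O}) = g.
  apply/polyP => i; rewrite coef_map coef_poly; case: ltnP => [_|le_i];
    first by rewrite cP.
  by rewrite nth_default // raddf0.
exists (\poly_(i < size g) c i) => //.
by move: g_mon; rewrite -{1}gE !monicE (lead_coef_map_inj val_inj) ?raddf0 // => /eqP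
  g1.
Qed.

Section Reduction.
Variables (F : fieldType) (red : {rmorphism O -> F}).
Hypothesis red_p : red p%:R = 0.
Hypothesis red_surj : forall c, exists x, red x = c.

Lemma map_red_surj (g : {poly F}) : exists f : {poly O}, map_poly red f = g.
Proof.
have /choice[c cP] i : exists x, red x = g`_i := red_surj _.
exists (\poly_(i < size g) c i); apply/polyP => i; rewrite coef_map coef_poly.
by case: ltnP => [_|le_i]; [exact: cP | rewrite nth_default // raddf0].
Qed.

Local Notation psi := (red \o padic_to_integers).

(** Modulo [g] the composite of [N] with [b] is the constant [N.[c]], and a nonconstant [g] divides
    no nonzero constant. *)
Lemma horner_eq0_dvdp_comp (g b N : {poly F}) (c : F) :
  (1 < size g)%N -> g %| b - c%:P -> g %| N \Po b -> N.[c] = 0.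
Proof.
move=> g_nc gb gN; apply/eqP; rewrite -polyC_eq0; apply: contraTT g_nc => Nc.
have : ('X - c%:P) \Po b %| (N - N.[c]%:P) \Po b.
  by apply: dvdp_comp_poly; rewrite dvdp_XsubCl rootE !hornerE subrr.
rewrite !comp_polyB comp_polyX !comp_polyC => /(dvdp_trans gb).
rewrite dvdp_addr // dvdpNr => /(dvdp_leq Nc); rewrite -leqNgt => /leq_trans; apply.
by rewrite size_polyC leq_b1.
Qed.

(** Plays the part of Hensel's lemma. *)
Lemma no_coprime_reduction (f : {poly O}) (g h : {poly F}) :
    f \is monic -> irreducible_poly (map_poly val f) ->
    coprimep g h -> g %| map_poly red f -> h %| map_poly red f ->
  size g = 1%N \/ size h = 1%N.
Proof.
move=> f_mon f_irr co_gh gf hf; apply: contrapT => /not_orP[g_size h_size].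
have fbar_neq0 : map_poly red f != 0 by rewrite monic_neq0 // monic_map.
have nc (d : {poly F}) : d %| map_poly red f -> size d <> 1%N -> (1 < size d)%N.
  move=> df /eqP d_size; rewrite ltn_neqAle eq_sym d_size size_poly_gt0.
  exact: dvdpN0 df fbar_neq0.
have [g_nc h_nc] := (nc g gf g_size, nc h hf h_size).
have /Bezout_eq1_coprimepP[[u v] /= uv1] := co_gh.
have [b bE] := map_red_surj (u * g).
have gb : g %| map_poly red b - 0%:P by rewrite bE subr0 dvdp_mulIr.
have hb : h %| map_poly red b - 1%:P.
  have -> : map_poly red b - 1%:P = - (v * h) by rewrite bE polyC1 -uv1; ring.
  by rewrite dvdpNr dvdp_mulIr.
have [L _ [z fz _]] := irredp_FAdjoin f_irr.
pose iota : {rmorphism K -> L} := in_alg L.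
pose iotaO : {rmorphism O -> L} := iota \o val.
pose iotaZ : {rmorphism Zp -> L} := iota \o padic_integer_in K.
have vals_int (N : {poly O}) : {in map_poly iotaO N : seq L, integralRange iotaZ}.
  by apply/integral_poly => i; rewrite coef_map; apply: integral_val.
have z_int : integralOver iotaZ z.
  apply: (@integral_root_monic _ _ _ _ (map_poly iotaO f)) => //;
    first exact: monic_map.
  by rewrite map_poly_comp.
set beta := (map_poly iotaO b).[z].
have beta_int : integralOver iotaZ beta by apply: integral_horner.
(* If [N] vanishes at [beta], the irreducible [f] divides the composite of [N] with [b], even over
   [O]. After reduction, [b] is [0] modulo [g] and [1] modulo [h], so the reduction of [N] vanishes
   at [0] and at [1]. *)
have key (N : {poly Zp}) : root (map_poly iotaZ N) beta ->
    (map_poly psi N).[0] = 0 /\ (map_poly psi N).[1] = 0.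
  move=> Nb; pose NO := map_poly padic_to_integers N \Po b.
  have [|Q NOE] := @monic_dvdp_descends _ _ val f NO val_inj f_mon.
    apply: (irreducible_dvdp_root f_irr fz); rewrite -map_poly_comp map_comp_poly.
    by rewrite rootE horner_comp -map_poly_comp.
  have fN : map_poly red f %| map_poly psi N \Po map_poly red b.
    by rewrite map_poly_comp -map_comp_poly -/NO NOE rmorphM dvdp_mulIr.
  split; first exact: horner_eq0_dvdp_comp g_nc gb (dvdp_trans gf fN).
  exact: horner_eq0_dvdp_comp h_nc hb (dvdp_trans hf fN).
have [M M_mon Mb] := beta_int.
have [E [[Q EQ] [j [G [Q' [j_gt0 EX]]]]]] := padic_idempotent M_mon.
have psi_p : red (padic_to_integers p%:R) = 0 by rewrite rmorph_nat red_p.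
have [M0 M1] := key M Mb.
(* Since [E] is [X^j] modulo [p] and [M], its reduction takes the value [0] at [0], as [j > 0], and
   [1] at [1]. But [E] or [E - 1] vanishes at [beta], which by [key] contradicts one of these
   values. *)
have EE c : (map_poly psi M).[c] = 0 -> (map_poly psi E).[c] = c ^+ j.
  move=> Mc; apply/eqP; rewrite -subr_eq0 -hornerXn -(map_polyXn psi) -hornerN -hornerD.
  by rewrite -rmorphB EX rmorphD !rmorphM /= map_polyC /= psi_p !hornerE Mc ?(mulr0,
    mul0r, addr0).
have : (map_poly iotaZ (E * (E - 1))).[beta] = 0.
  have -> : E * (E - 1) = Q * M by rewrite -EQ; ring.
  by rewrite rmorphM hornerM (rootP Mb) mulr0.
have E0 := EE 0 M0; have E1 := EE 1 M1.
rewrite rmorphM hornerM => /eqP; rewrite mulf_eq0 => /orP[/key[_]|/key[+ _]].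
  by rewrite E1 expr1n => /eqP; rewrite oner_eq0.
rewrite rmorphB rmorph1 hornerD hornerN E0 expr0n -[j == 0%N]negbK -lt0n j_gt0 hornerC.
by move=> /eqP; rewrite sub0r oppr_eq0 oner_eq0.
Qed.

End Reduction.

End RingOfIntegers.

(** * Reduction of splitting types and discriminants *)

Lemma finite_monic_splits (F : finFieldType) (f : {poly F}) : f \is monic ->
  exists (L : finFieldType) (iota : {rmorphism F -> L}) (r : seq L),
    map_poly iota f = \prod_(z <- r) ('X - z%:P).
Proof.
move=> f_mon; have [L [iota [r fr]]] := finite_splitting_field (monic_neq0 f_mon).
by exists L, iota, r; apply/eqP; rewrite -eqp_monic ?monic_prod_XsubC ?map_monic.
Qed.

(** Both types are the cycle type of Frobenius on the roots. *)
Lemma splitting_type_unique (F : finFieldType) (f : {poly F}) (mu mu' : seq nat) :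
    f \is monic -> squarefree_poly f ->
  has_splitting_type mu f -> has_splitting_type mu' f -> mu = mu'.
Proof.
move=> f_mon sqf f_mu f_mu'; have [L [iota [r fr]]] := finite_monic_splits f_mon.
have [x x_inj fx] := squarefree_root_poly sqf fr (erefl _).
have [s xs] := root_poly_frob_perm x_inj fx.
have := splitting_type_perm_class x_inj xs fx f_mu.
have := splitting_type_perm_class x_inj xs fx f_mu'.
by rewrite !inE => /eqP<- /eqP.
Qed.

Lemma squarefree_coprimep_deriv (F : finFieldType) (f : {poly F}) :
  f \is monic -> squarefree_poly f -> coprimep f f^`().
Proof.
move=> f_mon sqf; have [L [iota [r fr]]] := finite_monic_splits f_mon.
rewrite -(coprimep_map iota) -deriv_map fr.
have := separable_prod_XsubC r; rewrite unlock => ->.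
exact: squarefree_uniq_roots sqf fr.
Qed.

Lemma coprimep_deriv_squarefree (F : fieldType) (f : {poly F}) :
  coprimep f f^`() -> squarefree_poly f.
Proof.
move=> co_f g g2f; have gf : g %| f by apply: dvdp_trans g2f; rewrite exprS dvdp_mulIl.
have gf' : g %| f^`().
  have [h ->] : exists h : {poly F}, f = h * g ^+ 2 by exists (f %/ g ^+ 2);
    rewrite divpK.
  rewrite expr2 !derivM; apply/dvdpP; exists (h^`() * g + h * (g^`() + g^`())); ring.
by apply/eqP; rewrite size_poly_eq1 (coprimepP _ _ co_f).
Qed.

(** The degree of [g] may drop under [phi], so [phi] need not carry the resultant to the resultant
    of the images. Instead, a kernel vector of the reduced Sylvester matrix gives [u f + v g = 0]
    with [deg v < deg f]; coprimality forces [v = 0], then [u = 0]. *)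
Lemma coprimep_map_resultant (A : comNzRingType) (F : fieldType)
    (phi : {rmorphism A -> F}) (f g : {poly A}) :
  f \is monic -> coprimep (map_poly phi f) (map_poly phi g) ->
  phi (resultant f g) != 0.
Proof.
move=> f_mon co_fg; rewrite -det_map_mx; apply/negP => /det0P[uv nz_uv].
have fbar_size : size (map_poly phi f) = size f by rewrite size_map_poly_id0 // (eqP
  f_mon) rmorph1 oner_neq0.
have bandE d e (h : {poly A}) :
    map_mx phi (lin1_mx (poly_rV \o h \o* rVpoly) : 'M[A]_(d, e)) =
    lin1_mx (poly_rV \o map_poly phi h \o* rVpoly).
  by apply: map_lin1_mx => v; rewrite map_poly_rV rmorphM /= map_rVpoly.
rewrite /Sylvester_mx map_col_mx !bandE.
rewrite -[uv]hsubmxK mul_row_col !mul_rV_lin1 /=.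
set u := rVpoly _; set v := rVpoly _.
have uf_size : (size (u * map_poly phi f)%R <= (size g).-1 + (size f).-1)%N.
  rewrite (leq_trans (size_polyMleq _ _)) // -subn1 leq_subLR fbar_size.
  by rewrite addnCA leq_add ?leqSpred ?size_poly.
have vg_size : (size (v * map_poly phi g)%R <= (size g).-1 + (size f).-1)%N.
  rewrite (leq_trans (size_polyMleq _ _)) // -subn1 leq_subLR addnC addnA leq_add
    ?size_poly //.
  by apply: leq_trans (size_poly _ _) _; apply: leqSpred.
move/(congr1 rVpoly)/eqP; rewrite -linearD linear0 poly_rV_K; last first.
  by rewrite (leq_trans (size_polyD _ _)) // geq_max uf_size.
rewrite addrC addr_eq0 => /eqP vg_uf.
have fv : map_poly phi f %| v.
  by rewrite -(Gauss_dvdpl _ co_fg) vg_uf dvdpNr dvdp_mulIr.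
have fbar_mon : map_poly phi f \is monic by apply: monic_map.
have v0 : v = 0.
  apply/eqP; apply: contraTT fv => v_neq0; apply/negP => /(dvdp_leq v_neq0).
  rewrite fbar_size leqNgt; apply/negP; rewrite negbK.
  by rewrite -[size f]prednK ?size_poly_gt0 ?monic_neq0 // ltnS size_poly.
have u0 : u = 0.
  apply/eqP; move/eqP: vg_uf; rewrite v0 mul0r eq_sym oppr_eq0 mulf_eq0.
  by rewrite [map_poly phi f == 0](negPf (monic_neq0 fbar_mon)) orbF.
case/negP: nz_uv; rewrite -[uv]hsubmxK.
by rewrite -[lsubmx uv]rVpolyK -[rsubmx uv]rVpolyK -/u -/v u0 v0 !linear0 row_mx0.
Qed.

Section Transfer.
Variables (p : nat) (p_pr : prime p) (K : fieldExtType (padic_number p_pr)).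
Local Notation O := (ring_of_integers K).
Variables (F : finFieldType) (red : {rmorphism O -> F}).
Hypothesis red_p : red p%:R = 0.
Hypothesis red_surj : forall c, exists x, red x = c.

Lemma integers_natr_eq0 m : (m%:R == 0 :> O) = (m == 0%N).
Proof.
rewrite -(inj_eq val_inj) rmorph0 rmorph_nat -(rmorph_nat (in_alg K)) fmorph_eq0.
by rewrite -(rmorph_nat (@FracField.tofrac _)) tofrac_eq0 padic_natr_eq0.
Qed.

(** In a squarefree reduction every divisor is coprime to its cofactor, so [no_coprime_reduction]
    applies to the two. *)
Lemma irreducible_reduction (f : {poly O}) :
    f \is monic -> irreducible_poly (map_poly val f) ->
  squarefree_poly (map_poly red f) -> irreducible_poly (map_poly red f).
Proof.
move=> f_mon f_irr sqf; have fbar_mon : map_poly red f \is monic by apply: monic_map.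
have fbar_size : size (map_poly red f) = size (map_poly val f).
  by rewrite !size_map_poly_id0 // (eqP f_mon) rmorph1 oner_neq0.
split=> [|d d_size df]; first by rewrite fbar_size; case: f_irr.
have [e def_f] : exists e, map_poly red f = e * d.
  by exists (map_poly red f %/ d); rewrite divpK.
have co_de : coprimep d e.
  apply/coprimepP => g gd ge; rewrite -size_poly_eq1; apply/eqP/sqf.
  by rewrite def_f expr2 dvdp_mul.
have ef : e %| map_poly red f by rewrite def_f dvdp_mulIl.
case: (no_coprime_reduction red_p red_surj f_mon f_irr co_de df ef) => [d1|/eqP].
  by rewrite d1 in d_size.
rewrite size_poly_eq1 => e1; rewrite def_f -{1}[d]mul1r eqp_mul2r 1?eqp_sym //.
by apply: dvdpN0 df _; apply: monic_neq0.
Qed.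

Lemma squarefree_dvdp (g f : {poly F}) :
  g %| f -> squarefree_poly f -> squarefree_poly g.
Proof. by move=> gf sqf d dg; apply: sqf (dvdp_trans dg gf). Qed.

Lemma splitting_type_reduction (f : {poly O}) (mu : seq nat) :
    f \is monic -> squarefree_poly (map_poly red f) ->
  has_splitting_type mu (map_poly val f) -> has_splitting_type mu (map_poly red f).
Proof.
move=> f_mon sqf [s [s_irr def_f s_mu]].
have /choice[l lP] (g : {poly K}) : exists g' : {poly O}, g \in s ->
    g' \is monic /\ map_poly val g' = g.
  have [gs|] := boolP (g \in s); last by exists 0.
  have [g_mon g_irr] := s_irr g gs.
  have gf : g %| map_poly val f.
    by rewrite def_f (perm_big _ (perm_to_rem gs)) big_cons dvdp_mulIl.
  by have [g' g'_mon g'E] := monic_factor_integral f_mon g_mon gf; exists g'.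
have fE : f = \prod_(g <- s) l g.
  apply: (map_inj_poly val_inj (raddf0 _)); rewrite def_f rmorph_prod /=.
  by apply: eq_big_seq => g gs; rewrite (lP g gs).2.
have fbarE : map_poly red f = \prod_(g <- [seq map_poly red (l g) | g <- s]) g.
  by rewrite big_map fE rmorph_prod.
exists [seq map_poly red (l g) | g <- s]; split=> //.
  move=> _ /mapP[g gs ->]; have [g_mon g_irr] := s_irr g gs; have [l_mon lE] := lP g gs.
  split; first exact: monic_map.
  apply: irreducible_reduction => //; first by rewrite lE.
  apply: squarefree_dvdp sqf; rewrite fbarE (perm_big _ (perm_to_rem (map_f _ gs))).
  by rewrite big_cons dvdp_mulIl.
rewrite -s_mu -map_comp; congr (sort _ _); apply/eq_in_map => g gs /=.
have [l_mon lE] := lP g gs; rewrite -[in RHS]lE.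
by rewrite !size_map_poly_id0 // (eqP l_mon) rmorph1 oner_neq0.
Qed.

(** The resultant is a combination of [f] and its derivative over [O], and [phi] turns it into a
    nonzero constant. Used for the reduction and for the inclusion into [K]. *)
Lemma coprimep_deriv_resultant (E : fieldType) (phi : {rmorphism O -> E})
    (f : {poly O}) : f \is monic -> (2 < size f)%N -> phi (resultant f f^`()) != 0 ->
  coprimep (map_poly phi f) (map_poly phi f)^`().
Proof.
move=> f_mon f_size res_neq0; rewrite deriv_map.
(* The leading coefficient of the derivative is the degree of [f], which is nonzero in [O] by
   characteristic zero. *)
have f'_size : (1 < size f^`())%N.
  rewrite ltnNge; apply/negP => /leq_sizeP/(_ (size f).-2).
  have -> : (1 <= (size f).-2)%N by lia.
  move=> /(_ isT)/eqP; rewrite coef_deriv.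
  have -> : (size f).-2.+1 = (size f).-1 by lia.
  rewrite -lead_coefE (eqP f_mon) integers_natr_eq0; lia.
have [[u v] /= _ uv] := resultant_in_ideal (ltnW f_size) f'_size.
apply/Bezout_coprimepP; exists (map_poly phi u, map_poly phi v) => /=.
rewrite -!rmorphM -rmorphD -uv /= map_polyC /=.
by rewrite -size_poly_eq1 size_polyC res_neq0.
Qed.

Lemma red_monic_disc (f : {poly O}) :
  (red (monic_disc f) != 0) = (red (resultant f f^`()) != 0).
Proof. by rewrite /monic_disc rmorphM rmorphXn rmorphN1 mulf_eq0 signr_eq0. Qed.

Lemma Pstar_reduction (P : idealr O) n mu (a : n.-tuple O) :
    (forall x, (red x == 0) = (x \in P)) -> (2 <= n)%N ->
  Pstar P n mu a <-> map_tuple red a \in sqfree_tuples F n mu.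
Proof.
move=> red_ker n_ge2; rewrite /Pstar /=; set f := monic_of_tuple a.
have f_mon : f \is monic := monic_of_tuple_monic a.
have f_size : (2 < size f)%N by rewrite size_monic_of_tuple ltnS.
have fbar_mon : map_poly red f \is monic by apply: monic_map.
have fK_mon : map_poly val f \is monic by apply: monic_map.
rewrite inE -map_monic_of_tuple -/f; rewrite -red_ker red_monic_disc.
have sqf_red : red (resultant f f^`()) != 0 -> squarefree_poly (map_poly red f).
  by move=> res; apply/coprimep_deriv_squarefree/coprimep_deriv_resultant.
split=> [[_ f_mu res]|/asboolP[sqf f_mu]].
  apply/asboolP; have sqf := sqf_red res.
  by split=> //; apply: splitting_type_reduction.
have res : red (resultant f f^`()) != 0.
  by apply: coprimep_map_resultant; rewrite // -deriv_map squarefree_coprimep_deriv.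
split=> //.
  apply/coprimep_deriv_squarefree/(@coprimep_deriv_resultant K val f) => //.
  apply: contraNneq res => res0; rewrite -(rmorph0 red); apply/eqP; congr (red _).
  by apply: val_inj; rewrite res0 rmorph0.
(* Over [K] the polynomial has some splitting type; it passes to the reduction, where the type is
   unique, so it is [mu]. *)
have [s sP def_f] := monic_irreducible_factorization fK_mon.
have f_mu' : has_splitting_type (sort geq [seq (size g).-1 | g : {poly K} <- s])
  (map_poly val f).
  by exists s.
rewrite (splitting_type_unique fbar_mon sqf f_mu (splitting_type_reduction f_mon sqf
  f_mu')).
exact: f_mu'.
Qed.

End Transfer.

(** * Measure of residue classes *)

Section FiniteFibers.
Local Open Scope classical_set_scope.
Variables (R : realType) (d : measure_display) (T : measurableType d).
Variables (mu : probability T R) (I : finType) (f : T -> I).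
Hypothesis f_meas : forall i, measurable [set x | f x = i].

Lemma measure_fibers (A : {set I}) :
  mu [set x | f x \in A] = (\sum_(i in A) mu [set x | f x = i])%E.
Proof.
have -> : [set x | f x \in A] = \bigcup_(i in [set` enum A]) [set x | f x = i].
  apply/seteqP; split=> [x fx|x [i /= iA fx]]; last by rewrite fx -mem_enum.
  by exists (f x); rewrite //= mem_enum.
rewrite measure_fin_bigcup //; last exact: trivIset_preimage1.
by rewrite -fsbig_seq ?enum_uniq // big_enum.
Qed.

End FiniteFibers.

Section Residues.
Local Open Scope classical_set_scope.
Variables (R : realType) (p : nat) (p_pr : prime p) (K : fieldExtType (padic_number
  p_pr)).
Local Notation O := (ring_of_integers K).
Variables (F : finFieldType) (red : {rmorphism O -> F}).
Hypothesis red_p : red p%:R = 0.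
Hypothesis red_surj : forall c, exists x, red x = c.
Variable h : probability O R.
Hypothesis h_haar : haar_measure h.

(** A residue class is a union of cosets of [p O], hence open. *)
Lemma measurable_residue c : measurable [set x : O | red x = c].
Proof.
have c_open : padic_open [set x : O | red x = c].
  by move=> x /= <-; exists 1%N => z;
    rewrite /= rmorphD rmorphM expr1 red_p mul0r addr0.
exact: sub_sigma_algebra c_open.
Qed.

(** The residue classes are translates of each other, so they share the total mass [1] equally. *)
Lemma haar_residue c : h [set x : O | red x = c] = (#|F|%:R^-1)%:E.
Proof.
have q_neq0 : #|F|%:R != 0 :> R by rewrite pnatr_eq0 -lt0n; apply/card_gt0P; exists 0.
have shift b : h [set x : O | red x = b] = h [set x : O | red x = 0].
  have [a ab] := red_surj b; rewrite -(h_haar a (measurable_residue 0)); congr (h _).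
  apply/seteqP; split=> [x /= xb|_ [x /= x0 <-]]; last by rewrite rmorphD x0 ab addr0.
  by exists (x - a); [rewrite /= rmorphB xb ab subrr | exact: subrKC].
have := measure_fibers h measurable_residue [set: F]%SET.
have -> : [set x : O | red x \in [set: F]%SET] = setT.
  by apply/seteqP; split=> x //= _; rewrite inE.
rewrite probability_setT (eq_bigr (fun=> h [set x : O | red x = 0])) => [|b _];
  last exact: shift.
rewrite (shift c) -(fineK (fin_num_measure h _ (measurable_residue 0))).
rewrite sumEFin => h1_fin; have := EFin_inj h1_fin.
rewrite sumr_const cardsT => h1.
by congr (_%:E); apply: (mulfI q_neq0); rewrite mulfV // mulr_natl h1.
Qed.

Section Tuples.
Variables (n : nat) (nu : probability (n.-tuple O) R).
Hypothesis nu_prod : product_measure h nu.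

Lemma residue_tupleE (t : n.-tuple F) : [set x : n.-tuple O | map_tuple red x = t] =
  [set x : n.-tuple O | forall i, [set y | red y = tnth t i] (tnth x i)].
Proof.
apply/seteqP; split=> [x /= <- i|x /= xt]; first by rewrite tnth_map.
by apply: eq_from_tnth => i; rewrite tnth_map xt.
Qed.

Lemma measurable_residue_tuple (t : n.-tuple F) :
  measurable [set x : n.-tuple O | map_tuple red x = t].
Proof.
rewrite residue_tupleE.
have -> : [set x : n.-tuple O | forall i, [set y | red y = tnth t i] (tnth x i)] =
    \bigcap_(i in [set: 'I_n]) ((@tnth n O) ^~ i @^-1` [set y | red y = tnth t i]).
  by apply/seteqP; split=> [x /= xt i _|x /= xt i]; apply: xt.
apply: fin_bigcap_measurable => // i _.
rewrite -[X in measurable X]setTI; apply: measurable_tnth => //.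
exact: measurable_residue.
Qed.

Lemma product_residue_tuples (A : {set n.-tuple F}) :
  nu [set x : n.-tuple O | map_tuple red x \in A] = (#|A|%:R / #|F|%:R ^+ n)%:E.
Proof.
rewrite (measure_fibers nu measurable_residue_tuple).
rewrite (eq_bigr (fun=> (#|F|%:R^-1 ^+ n)%:E)) => [|t _].
  by rewrite sumEFin sumr_const exprVn mulr_natl.
rewrite residue_tupleE (nu_prod (fun i => measurable_residue (tnth t i))).
rewrite (eq_bigr (fun=> (#|F|%:R^-1)%:E)) => [|i _]; last exact: haar_residue.
by rewrite prodEFin prodr_const card_ord.
Qed.

End Tuples.

End Residues.

(** * The deviation *)

Lemma residue_morphism (A : comNzRingType) (P : idealr A) (k : finFieldType) :
    residue_field P k ->
  exists red : {rmorphism A -> k},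
    (forall x, (red x == 0) = (x \in P)) /\ (forall c, exists x, red x = c).
Proof.
move=> [phi phi_bij]; have [psi phiK psiK] := phi_bij.
pose red : {rmorphism A -> k} := phi \o (\pi_{ideal_quot P})%qT.
exists red; split=> [x|c].
  rewrite /red /= -(rmorph0 phi) (inj_eq (bij_inj phi_bij)).
  by rewrite piE Quotient.equivE subr0.
by exists (generic_quotient.repr (psi c)); rewrite /red /= reprK psiK.
Qed.

Section Deviation.
Variables (R : realType) (F : finFieldType) (n : nat) (mu : seq nat).
Local Notation q := #|F|.
Local Notation dens := (#|sqfree_tuples F n mu|%:R / q%:R ^+ n : R).

Lemma nu_sym_gt0 : is_splitting_type n mu -> 0 < nu_sym R n mu.
Proof.
move=> /and3P[mu_sorted mu_gt0 /eqP mu_sum].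
by rewrite divr_gt0 ?ltr0n ?fact_gt0 // (perm_class_gt0 mu_gt0).
Qed.

(** The density never exceeds [nu_sym], so the absolute value is a difference of known sign and only
    the lower bound of the count matters. *)
Lemma sqfree_density_bound :
  `|dens - nu_sym R n mu| <= (n ^ 2)%:R / q%:R * nu_sym R n mu.
Proof.
have [le_up le_lo] := card_sqfree_tuples_bounds F n mu.
have q_gt0 : 0 < q%:R :> R by rewrite ltr0n; apply/card_gt0P; exists 0.
have f_gt0 : 0 < n`!%:R :> R by rewrite ltr0n fact_gt0.
have qn_gt0 : 0 < q%:R ^+ n :> R by rewrite exprn_gt0.
rewrite /nu_sym; move: le_up le_lo.
rewrite -!(ler_nat R) !(natrD, natrM) !natrX.
set N := #|sqfree_tuples F n mu|%:R; set C := #|perm_class n mu|%:R.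
set Q := _ ^+ n in qn_gt0 *; move=> le_up le_lo.
have le1 : N / Q <= C / n`!%:R.
  by rewrite ler_pdivrMr // mulrAC ler_pdivlMr.
rewrite distrC ger0_norm ?subr_ge0 // lerBlDr -lerBlDl.
have -> : C / n`!%:R - n%:R ^+ 2 / q%:R * (C / n`!%:R) = (C * q%:R - C * n%:R ^+ 2) /
  (q%:R * n`!%:R).
  by field; rewrite !gt_eqF.
rewrite ler_pdivrMr ?mulr_gt0 // mulrAC ler_pdivlMr //; lra.
Qed.

(** Follows from [n^2 / q <= m / q < m / (q - m)]. The two parts of the theorem are [m = n^2] and
    [m = n^2 + n]. *)
Lemma deviation_lt (m : nat) : is_splitting_type n mu -> (0 < n)%N -> (n ^ 2 <= m)%N
  -> (m < q)%N ->
  `|dens - nu_sym R n mu| < m%:R / (q%:R - m%:R) * nu_sym R n mu.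
Proof.
move=> mu_type n_gt0 le_nm lt_mq; apply: le_lt_trans sqfree_density_bound _.
have nu_gt0 := nu_sym_gt0 mu_type; rewrite ltr_pM2r //.
have m_gt0 : 0 < m%:R :> R by rewrite ltr0n (leq_trans _ le_nm) // expn_gt0 n_gt0.
have q_gt0 : 0 < q%:R :> R by rewrite ltr0n (leq_ltn_trans _ lt_mq).
have d_gt0 : 0 < q%:R - m%:R :> R by rewrite subr_gt0 ltr_nat.
apply: le_lt_trans (_ : m%:R / q%:R < _);
  first by rewrite ler_pM2r ?invr_gt0 // ler_nat.
by rewrite ltr_pM2l // ltf_pV2 ?posrE // ltrBlDr ltrDl.
Qed.

End Deviation.

(* Excludes [q = n^2 + n] for [n = 2], where division by zero makes the bound [0]. *)
Lemma prime_power_neq6 p f : prime p -> 6%N <> (p ^ f)%N.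
Proof.
move=> p_pr e6; have dvd_p r : prime r -> (r %| 6)%N -> r = p.
  move=> r_pr; rewrite e6 Euclid_dvdX // dvdn_prime2 // => /andP[/eqP].
  by [].
by have := dvd_p 2%N isT isT; rewrite -(dvd_p 3%N isT isT).
Qed.

Theorem theorem1p2 (R : realType) (n : nat) (mu : seq nat)
    (p : nat) (p_pr : prime p) (K : fieldExtType (padic_number p_pr))
    (P : idealr (ring_of_integers K)) (q f : nat) (Fq : finFieldType)
    (h : probability (ring_of_integers K) R)
    (nu : probability (n.-tuple (ring_of_integers K)) R) :
  (2 <= n)%N -> is_splitting_type n mu ->
  maximal_ideal P -> residue_field P Fq -> #|Fq| = q -> q = (p ^ f)%N ->
  haar_measure h -> product_measure h nu ->
  ((3 <= n)%N -> (n ^ 2 < q)%N ->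
     `| fine (nu (Pstar P n mu)) - nu_sym R n mu |
       < (n ^ 2)%:R / (q%:R - (n ^ 2)%:R) * nu_sym R n mu) /\
  (n = 2%N -> (n ^ 2 + n <= q)%N ->
     `| fine (nu (Pstar P n mu)) - nu_sym R n mu |
       < (n ^ 2 + n)%:R / (q%:R - (n ^ 2 + n)%:R) * nu_sym R n mu).
Proof.
move=> n_ge2 mu_type _ /residue_morphism[red [red_ker red_surj]] card_q q_pf h_haar
  nu_prod.
have red_p : red p%:R = 0.
  have := card_finPcharP (etrans card_q q_pf) p_pr.
  by rewrite rmorph_nat => /pcharf0.
have -> : fine (nu (Pstar P n mu)) = #|sqfree_tuples Fq n mu|%:R / #|Fq|%:R ^+ n.
  have -> : Pstar P n mu = [set a | map_tuple red a \in sqfree_tuples Fq n mu]%classic.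
    by apply/seteqP; split=> a /(Pstar_reduction red_p red_surj mu a red_ker n_ge2).
  by rewrite (product_residue_tuples red_p red_surj h_haar nu_prod).
have n_gt0 : (0 < n)%N := ltnW n_ge2.
split=> [_ lt_q|n2 le_q]; rewrite -card_q in q_pf *.
  by apply: deviation_lt; rewrite ?card_q.
apply: deviation_lt; rewrite ?leq_addr // ltn_neqAle card_q le_q andbT.
by apply/eqP => e; apply: (@prime_power_neq6 p f p_pr); rewrite -q_pf card_q -e n2.
Qed.
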